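(* Suppose $\mathfrak C$ is one-sorted, $<$ is a $\emptyset$-definable linear order on $\mathfrak C$ and $\operatorname{Th}(\mathfrak C,<,\dots)$ is weakly o-minimal. Let $A$ be small, $(D,\triangleleft)$ an $A$-definable linear order and $f:\mathfrak C\to D$ an $A$-definable function. Then: (i) There exist a finite partition $\mathcal C$ of $\mathfrak C$ into $A$-definable $<$-convex sets and a $\subseteq$-increasing sequence $\vec E$ of $A$-definable $<$-convex equivalence relations on $\mathfrak C$ such that $f$ is $(<_{\vec E},\triangleleft)$-increasing on each member of $\mathcal C$. (ii) There exist a finite partition $\mathcal C$ of $\mathfrak C$ into $A$-definable $<$-convex sets and an $A$-definable $<$-convex equivalence relation $E$ on $\mathfrak C$ with only finitely many finite classes, such that $E=\bigcup_{C\in\mathcal C}E\restriction C$ and, for each $C\in\mathcal C$, the restriction $f\restriction[a]_E$ is constant, or strictly $(<,\triangleleft)$-increasing, or strictly $(<,\triangleleft)$-decreasing, the same alternative holding uniformly for all $a\in C$.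
   Context: $\mathfrak C$ is the monster model of a complete theory; ''definable'' means with parameters. The theory is weakly o-minimal (with respect to $<$) if in every model every definable subset of the universe is a finite union of $<$-convex sets. For a linear order $(X,<)$ and a convex equivalence relation $E$, define $x<_E y$ iff $(E(x,y)\wedge y<x)\vee(\neg E(x,y)\wedge x<y)$; for a sequence $\vec E=(E_1,\dots,E_n)$ of pairwise $\subseteq$-comparable convex equivalence relations, $<_{\vec E}:=(\cdots(<_{E_1})_{E_2}\cdots)_{E_n}$. A function $g$ is $(<_X,<_Y)$-increasing if $x<_Xx'$ implies $g(x)\le_Y g(x')$. *)

(* Defs.v *)
From mathcomp Require Import all_boot.
From mathcomp Require Import boolp classical_sets functions cardinality.
From Stdlib Require Import RelationClasses.

Set Implicit Arguments.
Unset Strict Implicit.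
Unset Printing Implicit Defensive.

Local Open Scope classical_set_scope.
Local Open Scope card_scope.

Record language := Language {
  funsym : Type;
  funsym_ar : funsym -> nat;
  relsym : Type;
  relsym_ar : relsym -> nat }.

(* Formulas are intrinsically scoped: [formula L n] is the type of formulas
   whose free variables are among the [n] variables indexed by ['I_n]. *)
Inductive term (L : language) (n : nat) : Type :=
| Var of 'I_n
| App (s : funsym L) of ('I_(funsym_ar s) -> term L n).

(* [FAll] binds the variable of index 0 of its body. *)
Inductive formula (L : language) : nat -> Type :=
| FFalse n : formula L n
| FEq n : term L n -> term L n -> formula L n
| FRel n (r : relsym L) : ('I_(relsym_ar r) -> term L n) -> formula L n
| FImp n : formula L n -> formula L n -> formula L n
| FAll n : formula L n.+1 -> formula L n.

Record structure (L : language) := Structure {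
  carrier :> Type;
  carrier_inhabited : inhabited carrier;
  fun_interp : forall s : funsym L, ('I_(funsym_ar s) -> carrier) -> carrier;
  rel_interp : forall r : relsym L, ('I_(relsym_ar r) -> carrier) -> Prop }.

Definition vcons T n (x : T) (v : 'I_n -> T) : 'I_n.+1 -> T :=
  fun i => if unlift ord0 i is Some j then v j else x.

Definition vcat T m n (v : 'I_m -> T) (w : 'I_n -> T) : 'I_(m + n) -> T :=
  fun i => match fintype.split i with inl j => v j | inr k => w k end.

Definition vec1 T (x : T) : 'I_1 -> T := fun=> x.

Definition vec2 T (x y : T) : 'I_2 -> T := vcons x (vec1 y).

Fixpoint eval L (M : structure L) n (v : 'I_n -> M) (t : term L n) : M :=
  match t with
  | Var i => v i
  | App s ts => fun_interp (fun i => eval v (ts i))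
  end.

Fixpoint sat L (M : structure L) n (phi : formula L n) : ('I_n -> M) -> Prop :=
  match phi in formula _ n return ('I_n -> M) -> Prop with
  | FFalse _ => fun=> False
  | FEq _ t u => fun v => eval v t = eval v u
  | FRel _ r ts => fun v => rel_interp (fun i => eval v (ts i))
  | FImp _ phi psi => fun v => sat phi v -> sat psi v
  | FAll _ phi => fun v => forall x : M, sat phi (vcons x v)
  end.

Definition sentence L := formula L 0.

Definition novars T : 'I_0 -> T := fun i => False_rect T (notF (ltn_ord i)).

Definition models L (M : structure L) (T : set (sentence L)) :=
  forall phi, T phi -> sat phi (@novars M).

Definition Th L (M : structure L) : set (sentence L) :=
  [set phi | sat phi (@novars M)].

(* An L(A)-formula in [n] free variables: a formula in [n + k] variables
   together with a [k]-tuple of parameters from [A]. *)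
Record pformula L (M : structure L) (A : set M) (n : nat) := PFormula {
  pf_ar : nat;
  pf_formula : formula L (n + pf_ar);
  pf_param : 'I_pf_ar -> M;
  pf_paramP : forall i, A (pf_param i) }.

Definition psat L (M : structure L) (A : set M) n (phi : pformula A n)
    (v : 'I_n -> M) : Prop :=
  sat (pf_formula phi) (vcat v (@pf_param _ _ _ _ phi)).

Definition definable L (M : structure L) (A : set M) n
    (X : set ('I_n -> M)) : Prop :=
  exists phi : pformula A n, X = [set v | psat phi v].

Definition definable_set L (M : structure L) (A : set M) (X : set M) : Prop :=
  definable A [set v : 'I_1 -> M | X (v ord0)].

Definition definable_rel L (M : structure L) (A : set M) n
    (R : ('I_n -> M) -> ('I_n -> M) -> Prop) : Prop :=
  definable A [set v : 'I_(n + n) -> M |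
    R (fun i => v (lshift n i)) (fun i => v (rshift n i))].

Definition definable_rel1 L (M : structure L) (A : set M)
    (E : M -> M -> Prop) : Prop :=
  definable_rel A (fun v w : 'I_1 -> M => E (v ord0) (w ord0)).

Definition definable_fun L (M : structure L) (A : set M) n
    (f : M -> ('I_n -> M)) : Prop :=
  definable A [set v : 'I_(1 + n) -> M |
    f (v (lshift n ord0)) = (fun i => v (rshift 1 i))].

Definition strict_linear_order_on T (D : set T) (lt : T -> T -> Prop) : Prop :=
  [/\ forall x y, lt x y -> D x /\ D y,
      StrictOrder lt &
      forall x y, D x -> D y -> [\/ lt x y, x = y | lt y x]].

Definition strict_linear_order T (lt : T -> T -> Prop) : Prop :=
  strict_linear_order_on setT lt.

Definition convex T (lt : T -> T -> Prop) (C : set T) : Prop :=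
  forall x y z, C x -> C z -> lt x y -> lt y z -> C y.

Definition eclass T (E : T -> T -> Prop) (a : T) : set T := [set x | E a x].

Definition convex_equiv T (lt E : T -> T -> Prop) : Prop :=
  Equivalence E /\ forall a, convex lt (eclass E a).

Definition lt_twist T (lt E : T -> T -> Prop) : T -> T -> Prop :=
  fun x y => (E x y /\ lt y x) \/ (~ E x y /\ lt x y).

(* [codom E] lists [E_0, ..., E_(m-1)] in this order, so that the twist by
   [E_0] is innermost; for [m = 0] this is [lt] itself. *)
Definition lt_twists T (lt : T -> T -> Prop) m
    (E : 'I_m -> T -> T -> Prop) : T -> T -> Prop :=
  foldl (@lt_twist T) lt (codom E).

Definition increasing_chain T m (E : 'I_m -> T -> T -> Prop) : Prop :=
  forall i j : 'I_m, i <= j -> forall x y, E i x y -> E j x y.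

Definition increasing_on T U (C : set T) (ltT : T -> T -> Prop)
    (ltU : U -> U -> Prop) (f : T -> U) : Prop :=
  forall x y, C x -> C y -> ltT x y -> f x = f y \/ ltU (f x) (f y).

Definition strictly_increasing_on T U (C : set T) (ltT : T -> T -> Prop)
    (ltU : U -> U -> Prop) (f : T -> U) : Prop :=
  forall x y, C x -> C y -> ltT x y -> ltU (f x) (f y).

Definition strictly_decreasing_on T U (C : set T) (ltT : T -> T -> Prop)
    (ltU : U -> U -> Prop) (f : T -> U) : Prop :=
  forall x y, C x -> C y -> ltT x y -> ltU (f y) (f x).

Definition constant_on T U (C : set T) (f : T -> U) : Prop :=
  forall x y, C x -> C y -> f x = f y.

Definition finite_convex_partition L (M : structure L) (A : set M)
    (lt : M -> M -> Prop) (P : set (set M)) : Prop :=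
  [/\ finite_set P, partition P id setT &
      forall C, P C -> definable_set A C /\ convex lt C].

Definition lt_of L (M : structure L) (lt : formula L 2) : M -> M -> Prop :=
  fun x y => sat lt (vec2 x y).
Arguments lt_of {L} M lt.

Definition weakly_ominimal_theory L (T : set (sentence L))
    (lt : formula L 2) : Prop :=
  forall N : structure L, models N T ->
  forall X : set N, definable_set setT X ->
  exists F : set (set N),
    [/\ finite_set F, forall C, F C -> convex (lt_of N lt) C &
        X = \bigcup_(C in F) C].

(* The cardinal kappa is given by a type [K] of that cardinality. *)
Definition card_lt T U (A : set T) (B : set U) : Prop :=
  (A #<= B) && ~~ (B #<= A).

Definition small (K : Type) T (A : set T) : Prop := card_lt A [set: K].

Definition saturated (K : Type) L (M : structure L) : Prop :=
  forall A : set M, small K A ->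
  forall p : set (pformula A 1),
    (forall q, q `<=` p -> finite_set q ->
       exists x : M, forall phi, q phi -> psat phi (vec1 x)) ->
    exists x : M, forall phi, p phi -> psat phi (vec1 x).

Definition partial_elementary L (M : structure L) (A : set M)
    (g : M -> M) : Prop :=
  forall n (phi : formula L n) (a : 'I_n -> M),
    (forall i, A (a i)) -> (sat phi a <-> sat phi (fun i => g (a i))).

Definition automorphism L (M : structure L) (s : M -> M) : Prop :=
  [/\ bijective s,
      forall (F : funsym L) v,
        s (fun_interp (s := F) v) = fun_interp (s := F) (fun i => s (v i)) &
      forall (r : relsym L) v,
        rel_interp (r := r) v <-> rel_interp (r := r) (fun i => s (v i))].

Definition strongly_homogeneous (K : Type) L (M : structure L) : Prop :=
  forall (A : set M) (g : M -> M), small K A -> partial_elementary A g ->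
  exists s, automorphism s /\ forall a, A a -> s a = g a.

(* [{n & formula L n}] has cardinality max(|L|, aleph_0). *)
Definition monster (K : Type) L (M : structure L) : Prop :=
  [/\ small K [set: {n : nat & formula L n}],
      saturated K M & strongly_homogeneous K M].

(* Main.v *)
Require Import Defs.
From mathcomp Require Import all_boot.
From mathcomp Require Import boolp classical_sets functions cardinality.
From Stdlib Require Import RelationClasses.

(* Only the preorder x, y |-> f x <| f y on the line matters. By saturation and
   weak o-minimality, a definable family of subsets indexed by the line has a
   uniform bound on the number of alternations of its members.

   For a convex equivalence relation E and a colour s in {<, =, >}, let
   [ext s E] relate x and y when any two E-inequivalent points u < v of the
   E-hull of [x, y] satisfy f u s f v; this is again a convex equivalence
   relation. The points whose class is not enlarged by any of the three colours
   ("terminal" points) meet finitely many E-classes: on a convex set of terminal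
   points, colours to the left are either constant near each point, in which case
   {x > c | f z s f x for all z in [c, x)} alternates arbitrarily often, or vary
   on the class immediately below each point, in which case {z | f z <| f b} does.

   With E the equality this yields (ii). For (i), [ext] is iterated along words of
   colours. Consecutive colours differ, so the iteration stops by the bound on
   alternations of {y | f a <| f y}, and up to finitely many classes every point
   ends up terminal at some level; hence the line is covered by finitely many
   classes, and on such a class f is monotone for a suitable iterated twist. *)

Set Implicit Arguments.
Unset Strict Implicit.
Unset Printing Implicit Defensive.

Local Open Scope classical_set_scope.

(** * Definable relations *)

Lemma vcons0 T n (x : T) (v : 'I_n -> T) : vcons x v ord0 = x.
Proof. by rewrite /vcons unlift_none. Qed.

Lemma vcons_lift T n (x : T) (v : 'I_n -> T) i : vcons x v (lift ord0 i) = v i.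
Proof. by rewrite /vcons liftK. Qed.

Lemma vcat_lshift T m n (v : 'I_m -> T) (w : 'I_n -> T) i :
  vcat v w (lshift n i) = v i.
Proof. by rewrite /vcat (unsplitK (inl i)). Qed.

Lemma vcat_rshift T m n (v : 'I_m -> T) (w : 'I_n -> T) i :
  vcat v w (rshift m i) = w i.
Proof. by rewrite /vcat (unsplitK (inr i)). Qed.

Lemma vcat_comp T U m n (h : T -> U) (v : 'I_m -> T) (w : 'I_n -> T) :
  h \o vcat v w = vcat (h \o v) (h \o w).
Proof. by apply: funext => i; rewrite /vcat /=; case: fintype.split. Qed.

Lemma vcons_comp T U n (h : T -> U) x (v : 'I_n -> T) :
  h \o vcons x v = vcons (h x) (h \o v).
Proof. by apply: funext => i; rewrite /vcons /=; case: unlift. Qed.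

Lemma vcons_ord0 T n (v : 'I_n.+1 -> T) : vcons (v ord0) (v \o lift ord0) = v.
Proof.
apply: funext => i; rewrite /vcons.
by case: unliftP => [j ->|->].
Qed.

Lemma vcons_vcat T m n (x : T) (v : 'I_m -> T) (w : 'I_n -> T) :
  vcons x (vcat v w) = vcat (vcons x v) w :> ('I_(m.+1 + n) -> T).
Proof.
rewrite -[RHS](@vcons_ord0 _ (m + n)); congr vcons.
  have -> : @ord0 (m + n) = lshift n (@ord0 m) by apply: val_inj.
  by rewrite vcat_lshift vcons0.
apply: funext => i; rewrite -(splitK i) /=; case: fintype.split => j /=.
  have -> : lift ord0 (lshift n j) = lshift n (lift ord0 j) by apply: val_inj.
  by rewrite !vcat_lshift vcons_lift.
have -> : lift ord0 (rshift m j) = @rshift m.+1 n j by apply: val_inj.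
by rewrite vcat_rshift (@vcat_rshift _ m.+1).
Qed.

(** * Substitution of variables in terms and formulas *)

Section Renaming.
Context (L : language) (M : structure L).

Fixpoint term_rename n m (r : 'I_n -> 'I_m) (t : term L n) : term L m :=
  match t with
  | Var i => Var L (r i)
  | App s ts => App (fun i => term_rename r (ts i))
  end.

Fixpoint rename n (phi : formula L n) : forall m, ('I_n -> 'I_m) -> formula L m :=
  match phi in formula _ n return forall m, ('I_n -> 'I_m) -> formula L m with
  | FFalse _ => fun m _ => FFalse L m
  | FEq _ t u => fun m r => FEq (term_rename r t) (term_rename r u)
  | FRel _ R ts => fun m r => FRel (fun i => term_rename r (ts i))
  | FImp _ phi psi => fun m r => FImp (rename phi r) (rename psi r)
  | FAll _ phi => fun m r => FAll (rename phi (vcons ord0 (lift ord0 \o r)))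
  end.

Lemma eval_rename n m (r : 'I_n -> 'I_m) (t : term L n) (v : 'I_m -> M) :
  eval v (term_rename r t) = eval (v \o r) t.
Proof. by elim: t => //= s ts IH; congr fun_interp; apply: funext => i. Qed.

Lemma sat_rename n (phi : formula L n) m (r : 'I_n -> 'I_m) (v : 'I_m -> M) :
  sat (rename phi r) v <-> sat phi (v \o r).
Proof.
elim: phi m r v => {n} //= [n t u|n R ts|n phi IH1 psi IH2|n phi IH] m r v.
- by rewrite !eval_rename.
- by under [in X in X <-> _]eq_fun do rewrite eval_rename.
- by rewrite IH1 IH2.
- have E x : vcons x v \o vcons ord0 (lift ord0 \o r) = vcons x (v \o r).
    rewrite vcons_comp vcons0; congr vcons; apply: funext => i /=.
    by rewrite vcons_lift.
  by split=> H x; move: (H x); rewrite IH E.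
Qed.

End Renaming.

(** * Closure properties of predicates definable over [A] *)

Section Definability.
Context (L : language) (M : structure L) (A : set M).

Definition dfn n (P : ('I_n -> M) -> Prop) : Prop :=
  exists phi : pformula A n, forall v, P v <-> psat phi v.

Lemma definableE n (X : set ('I_n -> M)) : definable A X <-> dfn X.
Proof.
split=> [[phi ->]|[phi H]]; exists phi => //.
by apply/seteqP; split=> v /H.
Qed.

Lemma dfn_ext n (P Q : ('I_n -> M) -> Prop) :
  (forall v, P v <-> Q v) -> dfn P -> dfn Q.
Proof. by move=> PQ [phi H]; exists phi => v; rewrite -PQ. Qed.

Lemma dfn_subst n m (r : 'I_n -> 'I_m) (P : ('I_n -> M) -> Prop) :
  dfn P -> dfn (fun v => P (fun i => v (r i))).
Proof.
move=> [[k phi w wA] H].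
(* Only the free variables are renamed; the [k] trailing parameter variables are kept. *)
pose r' : 'I_(n + k) -> 'I_(m + k) := vcat (@lshift m k \o r) (@rshift m k).
exists (PFormula (rename phi r') wA) => v; rewrite H /psat /= sat_rename.
suff -> : vcat v w \o r' = vcat (v \o r) w by [].
rewrite vcat_comp; congr vcat; apply: funext => i /=.
  by rewrite vcat_lshift.
by rewrite vcat_rshift.
Qed.

Lemma dfn_False n : dfn (fun _ : 'I_n -> M => False).
Proof.
have wA : forall i : 'I_0, A (@novars M i) by case.
by exists (PFormula (FFalse L (n + 0)) wA) => v; split.
Qed.

Lemma dfn_imp n (P Q : ('I_n -> M) -> Prop) :
  dfn P -> dfn Q -> dfn (fun v => P v -> Q v).
Proof.
move=> [[k phi w wA] HP] [[l psi z zA] HQ].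
(* The two parameter tuples are concatenated; [r1] and [r2] select the two blocks. *)
pose r1 : 'I_(n + k) -> 'I_(n + (k + l)) :=
  vcat (@lshift n (k + l)) (@rshift n (k + l) \o @lshift k l).
pose r2 : 'I_(n + l) -> 'I_(n + (k + l)) :=
  vcat (@lshift n (k + l)) (@rshift n (k + l) \o @rshift k l).
have yA i : A (vcat w z i) by rewrite /vcat; case: fintype.split.
exists (PFormula (FImp (rename phi r1) (rename psi r2)) yA) => v.
rewrite HP HQ /psat /= !sat_rename !vcat_comp.
suff [-> ->] : vcat (vcat v (vcat w z) \o @lshift n (k + l))
      (vcat v (vcat w z) \o (@rshift n (k + l) \o @lshift k l)) = vcat v w /\
    vcat (vcat v (vcat w z) \o @lshift n (k + l))
      (vcat v (vcat w z) \o (@rshift n (k + l) \o @rshift k l)) = vcat v z by [].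
by split; congr vcat; apply: funext => i /=;
  rewrite ?vcat_lshift ?vcat_rshift ?vcat_lshift ?vcat_rshift.
Qed.

Lemma dfn_all n (P : ('I_n -> M) -> M -> Prop) :
  dfn (fun v => P (fun i => v (lift ord0 i)) (v ord0)) ->
  dfn (fun v => forall x, P v x).
Proof.
move=> [[k phi w wA] H]; exists (@PFormula L M A n k (FAll phi) w wA) => v.
have HP x : P v x <-> sat phi (vcons x (vcat v w)).
  rewrite vcons_vcat; have := H (vcons x v); rewrite /psat /= vcons0 => <-.
  by have -> : (fun i => vcons x v (lift ord0 i)) = v
    by apply: funext => i; rewrite vcons_lift.
by split=> HA x; apply/HP/HA.
Qed.

Lemma dfn_not n (P : ('I_n -> M) -> Prop) : dfn P -> dfn (fun v => ~ P v).
Proof. by move=> HP; apply: dfn_imp => //; apply: dfn_False. Qed.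

Lemma dfn_and n (P Q : ('I_n -> M) -> Prop) :
  dfn P -> dfn Q -> dfn (fun v => P v /\ Q v).
Proof.
move=> HP HQ; apply: (@dfn_ext _ (fun v => ~ (P v -> ~ Q v))).
  by move=> v; split=> [/not_implyP[? /contrapT]|[p q] h] //; apply: h.
by apply: dfn_not; apply: dfn_imp => //; apply: dfn_not.
Qed.

Lemma dfn_or n (P Q : ('I_n -> M) -> Prop) :
  dfn P -> dfn Q -> dfn (fun v => P v \/ Q v).
Proof.
move=> HP HQ; apply: (@dfn_ext _ (fun v => ~ P v -> Q v)).
  move=> v; split=> [h|[p|q]] //.
  by case: (pselect (P v)) => p; [left|right; apply: h].
by apply: dfn_imp => //; apply: dfn_not.
Qed.

Lemma dfn_iff n (P Q : ('I_n -> M) -> Prop) :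
  dfn P -> dfn Q -> dfn (fun v => P v <-> Q v).
Proof. by move=> HP HQ; apply: dfn_and; apply: dfn_imp. Qed.

Lemma dfn_ex n (P : ('I_n -> M) -> M -> Prop) :
  dfn (fun v => P (fun i => v (lift ord0 i)) (v ord0)) ->
  dfn (fun v => exists x, P v x).
Proof.
move=> HP; apply: (@dfn_ext _ (fun v => ~ forall x, ~ P v x)).
  by move=> v; rewrite -existsNE; split=> [[x /contrapT]|[x h]]; exists x => //; apply.
by apply/dfn_not/dfn_all/dfn_not.
Qed.

(** Values of [f] are tuples, so quantifiers over tuples are needed; one coordinate is quantified at
    a time. *)
Lemma dfn_exs k m (P : ('I_k -> M) -> ('I_m -> M) -> Prop) :
  dfn (fun v => P (fun i => v (lshift m i)) (fun i => v (rshift k i))) ->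
  dfn (fun w => exists p, P p w).
Proof.
elim: k m P => [|k IH] m P HP.
  pose r (i : 'I_(0 + m)) : 'I_m := i.
  apply: dfn_ext (dfn_subst r HP) => v.
  have -> : (fun i => v (r (@rshift 0 m i))) = v.
    by apply: funext => i; congr v; apply: val_inj.
  split=> [h|[p h]]; first by exists (fun i => v (r (lshift m i))).
  by have -> : (fun i => v (r (lshift m i))) = p by apply: funext => -[].
apply: (@dfn_ext _ (fun w => exists x p, P (vcons x p) w)).
  move=> w; split=> [[x [p h]]|[p h]]; first by exists (vcons x p).
  by exists (p ord0), (p \o lift ord0); rewrite vcons_ord0.
apply: dfn_ex; apply: (IH m.+1).
pose r : 'I_(k.+1 + m) -> 'I_(k + m.+1) :=
  vcat (vcons (rshift k ord0) (@lshift k m.+1)) (@rshift k m.+1 \o lift ord0).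
apply: dfn_ext (dfn_subst r HP) => v.
suff [-> ->] : (fun i => v (r (lshift m i))) =
   vcons (v (rshift k ord0)) (fun i => v (lshift m.+1 i)) /\
   (fun i => v (r (rshift k.+1 i))) = (fun i => v (rshift k (lift ord0 i))) by [].
split; apply: funext => i; rewrite /r ?vcat_lshift ?(@vcat_rshift _ k.+1) //.
by rewrite /vcons; case: unlift.
Qed.

Lemma dfn_big_and (I : finType) n (P : I -> ('I_n -> M) -> Prop) :
  (forall i, dfn (P i)) -> dfn (fun v => forall i, P i v).
Proof.
move=> HP; suff H (s : seq I) : dfn (fun v => forall i, i \in s -> P i v).
  apply: dfn_ext (H (enum I)) => v.
  by split=> h i => [|_]; apply: h; rewrite mem_enum.
elim: s => [|i s IH].
  by apply: dfn_ext (dfn_imp (dfn_False n) (dfn_False n)) => v; split.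
apply: dfn_ext (dfn_and (HP i) IH) => v; split=> [[h1 h2] j|h].
  by rewrite inE => /orP[/eqP->|/h2].
by split=> [|j js]; apply: h; rewrite inE ?eqxx ?js ?orbT.
Qed.

Definition def1 (X : set M) := dfn (fun v : 'I_1 -> M => X (v ord0)).

Definition def2 (R : M -> M -> Prop) :=
  dfn (fun v : 'I_2 -> M => R (v ord0) (v (lift ord0 ord0))).

Lemma dfn1 X n (i : 'I_n) : def1 X -> dfn (fun v => X (v i)).
Proof. exact: (@dfn_subst _ _ (fun=> i)). Qed.

Lemma dfn2 R n (i j : 'I_n) : def2 R -> dfn (fun v => R (v i) (v j)).
Proof.
move=> /(@dfn_subst _ _ (vcons i (fun=> j))) H.
by apply: dfn_ext H => v; rewrite vcons0 vcons_lift.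
Qed.

Lemma def1E X : definable_set A X <-> def1 X.
Proof. exact: definableE. Qed.

Lemma def2E R : definable_rel1 A R <-> def2 R.
Proof.
split=> [/definableE/(@dfn_subst _ 2 (vcat (fun=> ord0) (fun=> lift ord0 ord0))) H|H].
  by apply: dfn_ext H => v /=; rewrite vcat_lshift vcat_rshift.
by apply/definableE; apply: dfn2.
Qed.

End Definability.

Arguments dfn {L M} A {n} P.
Arguments def1 {L M} A X.
Arguments def2 {L M} A R.

(** Makes a fibre of a family over [A] definable with parameters: [u] joins the parameter tuple, at
    the cost of replacing [A] by the whole structure. *)
Lemma dfn_param L (M : structure L) (A : set M) n (P : ('I_n.+1 -> M) -> Prop) u :
  dfn A P -> dfn setT (fun v => P (vcons u v)).
Proof.
move=> [[k phi w wA] H].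
pose r : 'I_(n.+1 + k) -> 'I_(n + k.+1) :=
  vcat (vcons (rshift n ord0) (@lshift n k.+1)) (@rshift n k.+1 \o lift ord0).
exists (@PFormula L M setT n k.+1 (rename phi r) (vcons u w) (fun=> I)) => v.
rewrite H /psat /= sat_rename vcat_comp.
suff -> : vcat (vcat v (vcons u w) \o vcons (rshift n ord0) (@lshift n k.+1))
  (vcat v (vcons u w) \o (@rshift n k.+1 \o lift ord0)) = vcat (vcons u v) w by [].
congr vcat; last by apply: funext => i /=; rewrite vcat_rshift vcons_lift.
rewrite vcons_comp vcat_rshift vcons0; congr vcons.
by apply: funext => i /=; rewrite vcat_lshift.
Qed.

Lemma finite_set_range T (X : set T) : finite_set X ->
  exists k (r : 'I_k -> T), forall x, X x -> exists i, r i = x.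
Proof.
move=> [k] /card_set_bijP [g [gX gi gs]].
have [[x0 Xx0]|X0] := pselect (exists x, X x); last first.
  exists 0, (@novars T) => x Xx.
  by exfalso; apply: X0; exists x.
have /choice [h Hh] : forall i : 'I_k, exists x, g x = i :> nat /\ X x.
  move=> i; have [x Xx <-] := gs i (ltn_ord i); by exists x.
exists k, h => x Xx; exists (Ordinal (gX _ Xx)).
by apply: gi; rewrite ?inE //=; [case: (Hh (Ordinal (gX _ Xx)))|
  case: (Hh (Ordinal (gX _ Xx)))].
Qed.

Lemma dfn_comparison L (M : structure L) (A : set M) n
    (P : comparison -> ('I_n -> M) -> Prop) :
  (forall s, dfn A (P s)) -> dfn A (fun v => forall s, P s v).
Proof.
move=> H; apply: dfn_ext (dfn_and (H Lt) (dfn_and (H Eq) (H Gt))) => v.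
by split=> [[? [? ?]] []|h]; repeat split.
Qed.

Lemma def2_eq L (M : structure L) (A : set M) : def2 A (@eq M).
Proof.
have wA : forall i : 'I_0, A (@novars M i) by case.
exists (@PFormula L M A 2 0 (FEq (Var L (@lshift 2 0 ord0))
  (Var L (@lshift 2 0 (lift ord0 ord0)))) _ wA) => v.
by rewrite /psat /= !vcat_lshift.
Qed.

Lemma def2_lt_of L (M : structure L) (A : set M) (phi : formula L 2) :
  def2 A (lt_of M phi).
Proof.
have wA : forall i : 'I_0, A (@novars M i) by case.
exists (@PFormula L M A 2 0 (rename phi (@lshift 2 0)) _ wA) => v.
rewrite /psat /= sat_rename /lt_of.
suff -> : vec2 (v ord0) (v (lift ord0 ord0)) = vcat v (@novars M) \o @lshift 2 0 by [].
rewrite /vec2 -[RHS]vcons_ord0 /= vcat_lshift; congr vcons.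
apply: funext => i /=; rewrite vcat_lshift /vec1; congr v.
by rewrite (ord1 i).
Qed.

Create HintDb definability.
#[export] Hint Resolve def2_eq def2_lt_of : definability.

Ltac definability := cbv beta; repeat (first
  [ match goal with
    | H : def2 _ _ |- _ => solve [apply: (dfn2 _ _ H)]
    | H : def1 _ _ |- _ => solve [apply: (dfn1 _ H)]
    | H : forall _, def2 _ _ |- _ => solve [apply: (dfn2 _ _ (H _))]
    | H : forall _, def1 _ _ |- _ => solve [apply: (dfn1 _ (H _))]
    end
  | solve [apply: dfn2; solve [eauto with definability nocore]]
  | solve [apply: dfn1; solve [eauto with definability nocore]]
  | apply: dfn_False | apply: dfn_not | apply: dfn_and | apply: dfn_or
  | apply: dfn_iff | apply: dfn_ex | apply: dfn_imp | apply: dfn_all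
  | apply: dfn_comparison => ? | apply: dfn_big_and => ? ]; cbv beta).

(** * Alternations of a definable set *)

Section Alternations.
Context (L : language) (M : structure L) (A : set M) (lt : M -> M -> Prop).
Hypothesis lt_lin : strict_linear_order lt.
Hypothesis lt_def : def2 A lt.

Lemma lt_irr x : ~ lt x x.
Proof. by case: lt_lin => _ [irr _] _; exact: irr. Qed.

Lemma lt_trans y x z : lt x y -> lt y z -> lt x z.
Proof. by case: lt_lin => _ [_ tr] _; exact: tr. Qed.

Lemma lt_total x y : [\/ lt x y, x = y | lt y x].
Proof. by case: lt_lin => _ _ tot; exact: tot. Qed.

Lemma lt_asym x y : lt x y -> ~ lt y x.
Proof. by move=> xy yx; exact: (lt_irr (lt_trans xy yx)). Qed.

Definition le x y := lt x y \/ x = y.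

Lemma le_refl x : le x x. Proof. by right. Qed.

Lemma le_lt_trans y x z : le x y -> lt y z -> lt x z.
Proof. by case=> [h|->] //; apply: lt_trans. Qed.

Lemma lt_le_trans y x z : lt x y -> le y z -> lt x z.
Proof. by move=> xy [|<-] //; apply: lt_trans. Qed.

Lemma le_trans y x z : le x y -> le y z -> le x z.
Proof. by case=> [h|->] // yz; left; apply: lt_le_trans yz. Qed.

Lemma le_or_lt x y : le x y \/ lt y x.
Proof. by case: (lt_total x y) => h; [left; left|left; right|right]. Qed.

Lemma le_not_lt x y : le x y <-> ~ lt y x.
Proof.
split=> [[xy|->]|]; [exact: lt_asym|exact: lt_irr|].
by case: (le_or_lt x y).
Qed.

Lemma convexU (P Q : set M) y : convex lt P -> convex lt Q ->
  P y -> Q y -> convex lt (P `|` Q).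
Proof.
move=> Pc Qc Py Qy u w v [uP|uQ] [vP|vQ] uw wv.
- by left; apply: Pc uP vP uw wv.
- have [[wy|->]|yw] := le_or_lt w y; [|by left|].
    by left; apply: Pc uP Py uw wy.
  by right; apply: Qc Qy vQ yw wv.
- have [[wy|->]|yw] := le_or_lt w y; [|by left|].
    by right; apply: Qc uQ Qy uw wy.
  by left; apply: Pc Py vP yw wv.
- by right; apply: Qc uQ vQ uw wv.
Qed.

Definition fin_convex (X : set M) := exists (I : finType) (r : I -> set M),
  (forall i, convex lt (r i)) /\ forall x, X x <-> exists i, r i x.

(** Counts alternations downwards from [b]: it asks for [b >= x1 > y1 >= ... >= xn > yn] with every
    [xi] in [X] and no [yi] in [X]. *)
Fixpoint alt (X : set M) n b : Prop :=
  if n is n'.+1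
  then exists x y, [/\ le x b, lt y x, X x, ~ X y & alt X n' y]
  else True.

Lemma alt_le X n b c : le b c -> alt X n b -> alt X n c.
Proof.
case: n => //= n bc [x [y [xb yx Xx Xy a]]]; exists x, y; split=> //.
exact: le_trans bc.
Qed.

(** A step down from [x] in [X] to [y] outside [X] loses for good the convex piece containing [x],
    so there are no more alternations than pieces. *)
Lemma fin_convex_alt X : fin_convex X -> exists N, forall b, ~ alt X N b.
Proof.
move=> [I [r [rconv rX]]].
pose S b := [pred i : I | `[< exists2 w, r i w & le w b >]].
suff H n b : alt X n b -> n <= #|S b|.
  by exists #|I|.+1 => b /H; rewrite leqNgt ltnS max_card.
elim: n b => //= n IH b [x [y [xb yx Xx Xy /IH]]] /leq_ltn_trans; apply.
apply/proper_card/properP; split.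
  apply/fintype.subsetP => i /asboolP [w rw wy]; apply/asboolP; exists w => //.
  by left; apply: le_lt_trans wy (lt_le_trans yx xb).
have /rX[i rix] := Xx; exists i; first by apply/asboolP; exists x.
apply/asboolP => -[w rw wy]; apply: Xy; apply/rX; exists i.
case: wy => [wy|<-//]; exact: rconv rw rix wy yx.
Qed.

Lemma alt_def W n : def2 A W -> def2 A (fun u b => alt (W u) n b).
Proof.
move=> HW; elim: n => [|n IH] /=; rewrite /def2.
  by apply: (dfn_ext _ (dfn_imp (dfn_False A _) (dfn_False A _))).
apply: (@dfn_ext _ _ _ _ (fun v : 'I_2 -> M => exists x y,
  (lt x (v (lift ord0 ord0)) \/ x = v (lift ord0 ord0)) /\ lt y x /\
  W (v ord0) x /\ ~ W (v ord0) y /\ alt (W (v ord0)) n y)).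
  move=> v; split=> -[x [y]].
    by move=> [? [? [? [? ?]]]]; exists x, y.
  by move=> [? ? ? ? ?]; exists x, y.
by definability.
Qed.

Context (K : Type).
Hypothesis M_sat : saturated K M.
Hypothesis A_small : small K A.
Hypothesis M_wom : forall X, def1 setT X -> fin_convex X.

Lemma def1_param W u : def2 A W -> def1 setT (W u).
Proof.
move=> /(dfn_param u); apply: dfn_ext => v.
by rewrite vcons0 vcons_lift.
Qed.

(** If every number of alternations occurred in some fibre, saturation would give one [u] whose
    fibre alternates arbitrarily often, against weak o-minimality. *)
Lemma alt_bound W : def2 A W -> exists N, forall u b, ~ alt (W u) N b.
Proof.
move=> HW; apply: contrapT => noN.
have altS n : exists u b, alt (W u) n b.
  apply: contrapT => h; apply: noN; exists n => u b ub; apply: h.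
  by exists u, b.
(* Dropping the upper alternations lowers the count but moves the starting point, whence the new
   [b']. So a finite part of the type is satisfied as soon as its largest index is. *)
have altm m n u b : n <= m -> alt (W u) m b -> exists b', alt (W u) n b'.
  elim: m b => [|m IH] b; first by rewrite leqn0 => /eqP->; exists b.
  rewrite leq_eqVlt => /orP[/eqP->|]; first by exists b.
  by rewrite ltnS => nm /= [x [y [_ _ _ _ /(IH _ nm)]]].
have /choice [phi Hphi] : forall n, exists phi : pformula A 1,
    forall u, psat phi (vec1 u) <-> exists b, alt (W u) n b.
  move=> n; have Wn := alt_def n HW.
  have [phi H] : dfn A (fun v : 'I_1 -> M => exists b, alt (W (v ord0)) n b).
    by definability.
  by exists phi => u; rewrite -H.
have [q qp qfin|u Hu] := M_sat A_small (p := [set psi | exists n, psi = phi n]).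
  have [k [r Hr]] := finite_set_range qfin.
  have /choice [g Hg] : forall i, exists n, q (r i) -> r i = phi n.
    move=> i; have [/qp [n ->]|] := pselect (q (r i)); first by exists n.
    by exists 0.
  have [u [b ub]] := altS (\max_i g i).
  exists u => psi qpsi; have [i ri] := Hr _ qpsi.
  rewrite -ri Hg ?ri //; apply/Hphi; apply: altm ub.
  exact: leq_bigmax.
have [N HN] := fin_convex_alt (M_wom (def1_param u HW)).
have /Hphi [b] := Hu (phi N) (ex_intro _ N erefl); exact: HN.
Qed.

(** Let [b] in [Lo] see the largest possible number of alternations. Between [b] and a later point
    of [Lo] in [X] nothing is outside [X], or there would be one more; so on [Lo] above [b]
    membership changes at most once, from inside to outside. *)
Lemma germ X (Lo : set M) : fin_convex X -> (exists c, Lo c) ->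
  exists2 c, Lo c & forall z, Lo z -> le c z -> (X z <-> X c).
Proof.
move=> /fin_convex_alt [N HN] [c0 Lc0].
have [n [b Lb nb] nS] : exists2 n, (exists2 b, Lo b & alt X n b) &
    ~ exists2 b, Lo b & alt X n.+1 b.
  apply: contrapT => h.
  have : exists2 b, Lo b & alt X N b.
    elim: N {HN} => [|n IH]; first by exists c0.
    by apply: contrapT => h'; apply: h; exists n.
  by case=> b _; exact: HN.
have down y x : le b y -> lt y x -> Lo x -> X x -> X y.
  move=> by_ yx Lx Xx; apply: contrapT => Xy; apply: nS; exists x => //.
  by exists x, y; split=> //; [exact: le_refl|apply: alt_le nb].
have [[y Ly [by_ Xy]]|h] := pselect (exists2 y, Lo y & le b y /\ ~ X y).
  exists y => // z Lz [yz|->] //; split=> // Xz; exfalso; apply: Xy.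
  exact: down yz Lz Xz.
have {}h y : Lo y -> le b y -> X y.
  by move=> Ly by_; apply: contrapT => Xy; apply: h; exists y.
by exists b => // z Lz bz; split=> _; apply: h => //; exact: le_refl.
Qed.

End Alternations.

(** * Convex equivalence relations and terminal points *)

Section ConvexEquivalence.
Context (L : language) (M : structure L) (A : set M) (lt : M -> M -> Prop).
Hypothesis lt_lin : strict_linear_order lt.
Hypothesis lt_def : def2 A lt.
Local Notation ltT := (lt_trans lt_lin).
Local Notation ltI := (@lt_irr L M lt lt_lin).

(** [flt x y] stands for f x <| f y. It is a strict weak order: incomparability, the colour [Eq]
    below, is transitive. *)
Context (flt : M -> M -> Prop).
Hypothesis flt_def : def2 A flt.
Hypothesis flt_irr : forall x, ~ flt x x.
Hypothesis flt_trans : forall x y z, flt x y -> flt y z -> flt x z.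
Hypothesis flt_ntrans : forall x y z, flt x z -> flt x y \/ flt y z.
Hypothesis M_wom : forall W, def2 A W -> forall u, fin_convex lt (W u).
Hypothesis M_alt : forall W, def2 A W -> exists N, forall u b, ~ alt lt (W u) N b.

Definition col s x y := match s with
  | Lt => flt x y | Gt => flt y x | Eq => ~ flt x y /\ ~ flt y x end.

Section Far.
Variable E : M -> M -> Prop.
Hypothesis E_conv : convex_equiv lt E.

(** The order induced on the classes of [E]: a strict weak order whose incomparability relation is
    [E]. *)
Definition far x y := lt x y /\ ~ E x y.

Lemma ce_refl x : E x x. Proof. by case: E_conv => -[r _ _] _; exact: r. Qed.
Lemma ce_sym x y : E x y -> E y x.
Proof. by case: E_conv => -[_ s _] _; exact: s. Qed.
Lemma ce_trans y x z : E x y -> E y z -> E x z.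
Proof. by case: E_conv => -[_ _ t] _; exact: t. Qed.
Lemma ce_conv x y z : lt x y -> lt y z -> E x z -> E x y.
Proof.
move=> xy yz xz; case: E_conv => _ c.
exact: (c x x y z (ce_refl x) xz xy yz).
Qed.

Lemma far_lt x y : far x y -> lt x y. Proof. by case. Qed.

Lemma lt_far_trans y x z : lt x y -> far y z -> far x z.
Proof.
move=> xy [yz nyz]; split=> [|xz]; first exact: ltT xy yz.
by apply: nyz; apply: ce_trans (xz); apply/ce_sym; apply: ce_conv xz.
Qed.

Lemma far_lt_trans y x z : far x y -> lt y z -> far x z.
Proof.
move=> [xy nxy] yz; split=> [|xz]; first exact: ltT xy yz.
by apply: nxy; apply: ce_conv xz.
Qed.

Lemma far_trans y x z : far x y -> far y z -> far x z.
Proof. by move=> xy /far_lt; apply: far_lt_trans. Qed.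

Lemma far_irr x : ~ far x x. Proof. by move=> /far_lt; exact: ltI. Qed.

Lemma far_asym x y : far x y -> ~ far y x.
Proof. by move=> xy yx; apply: (far_irr (far_trans xy yx)). Qed.

Lemma far_total x y : [\/ far x y, E x y | far y x].
Proof.
have [xy|nxy] := pselect (E x y); first by constructor 2.
case: (lt_total lt_lin x y) => h; first by constructor 1.
  by case: nxy; rewrite h; exact: ce_refl.
by constructor 3; split=> // /ce_sym.
Qed.

Lemma ceP x y : E x y <-> ~ far x y /\ ~ far y x.
Proof.
split=> [xy|[]]; last by case: (far_total x y).
by split=> -[_] //; case; apply: ce_sym.
Qed.

Lemma far_ntrans y x z : far x z -> far x y \/ far y z.
Proof.
move=> xz; case: (far_total x y) => h; [by left| |right].
  right; case: xz => xz nxz; case: (far_total y z) => //.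
    by move/(ce_trans h).
  by case=> zy _; case: nxz; exact: ce_conv xz zy h.
exact: far_trans h xz.
Qed.

Lemma far_ce_r y x z : far x y -> E y z -> far x z.
Proof. by move=> /(far_ntrans z) [//|zy] /ceP[_ /(_ zy)]. Qed.

Lemma far_ce_l y x z : E x y -> far y z -> far x z.
Proof. by move=> /ceP[_ yx] /(far_ntrans x) []. Qed.

Lemma far_nfar y x z : far x y -> ~ far z y -> far x z.
Proof. by move=> /(far_ntrans z) []. Qed.

Lemma nfar_far y x z : ~ far y x -> far y z -> far x z.
Proof. by move=> yx /(far_ntrans x) []. Qed.

Lemma nfar_trans y x z : ~ far x y -> ~ far y z -> ~ far x z.
Proof. by move=> xy yz /(far_ntrans y) []. Qed.

(* The smallest convex [E]-saturated set containing [x] and [y], in a form that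
   does not require knowing which of the two is smaller. *)
Definition hull x y u := ~ (far u x /\ far u y) /\ ~ (far x u /\ far y u).

Lemma hullC x y u : hull x y u <-> hull y x u.
Proof. by rewrite /hull (and_comm (far u x)) (and_comm (far x u)). Qed.

Lemma hull_l x y : hull x y x. Proof. by split=> -[/far_irr]. Qed.

Lemma hull_r x y : hull x y y. Proof. exact/hullC/hull_l. Qed.

Lemma hull_convex x y : convex lt (hull x y).
Proof.
move=> u w v [u1 u2] [v1 v2] uw wv; split.
  by move=> [wx wy]; apply: u1; split; apply: lt_far_trans; eassumption.
by move=> [wx wy]; apply: v2; split; apply: far_lt_trans; eassumption.
Qed.

Lemma hull_ce x y u v : hull x y u -> E u v -> hull x y v.
Proof.
move=> [u1 u2] uv; split=> -[h1 h2].
  by apply: u1; split; apply: far_ce_l; eassumption.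
by apply: u2; split; apply: far_ce_r; try eassumption; exact: ce_sym.
Qed.

Lemma hull_sub x y u (Q : set M) : convex lt Q ->
  (forall u v, Q u -> E u v -> Q v) -> Q x -> Q y -> hull x y u -> Q u.
Proof.
move=> Qc QE Qx Qy [h1 h2].
case: (far_total x u) => xu; [|exact: QE xu|].
  case: (far_total y u) => yu; [by case: h2|exact: QE yu|].
  by apply: Qc Qx Qy _ _; apply: far_lt.
case: (far_total y u) => yu; [|exact: QE yu|by case: h1].
by apply: Qc Qy Qx _ _; apply: far_lt.
Qed.

Lemma hull_far x y u : far x y -> hull x y u <-> ~ far u x /\ ~ far y u.
Proof.
move=> xy; split=> [[h1 h2]|[h1 h2]].
  split=> h; [apply: h1|apply: h2]; split=> //; exact: far_trans h _ || exact: far_trans xy h.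
by split=> -[].
Qed.

(** * Sets meeting finitely many classes *)

Definition finite_classes (X : set M) := exists (I : finType) (r : I -> M),
  forall x, X x -> exists i, E (r i) x.

Lemma fc_sub X Y : (forall x, X x -> Y x) -> finite_classes Y -> finite_classes X.
Proof. by move=> XY [I [r H]]; exists I, r => x /XY/H. Qed.

Lemma fc_union (I : finType) (X : I -> set M) Y :
  (forall x, Y x -> exists i, X i x) ->
  (forall i, finite_classes (X i)) -> finite_classes Y.
Proof.
move=> XY /choice [J HJ]; pose r i := projT1 (cid (HJ i)).
exists {i : I & J i}, (fun p => r (tag p) (tagged p)) => x /XY [i].
by move=> /(projT2 (cid (HJ i))) [j ij]; exists (Tagged J j).
Qed.

Lemma fc_union2 X X' Y : (forall x, Y x -> X x \/ X' x) ->
  finite_classes X -> finite_classes X' -> finite_classes Y.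
Proof.
move=> XY fX fX'; apply: (@fc_union bool (fun b => if b then X else X')).
  by move=> x /XY [h|h]; [exists true|exists false].
by case.
Qed.

Lemma fc_single X : (forall x y, X x -> X y -> E x y) -> finite_classes X.
Proof.
move=> H; have [[x0 Xx0]|h] := pselect (exists x, X x).
  by exists unit, (fun=> x0) => x Xx; exists tt; apply: H.
by exists void, (@of_void M) => x Xx; case: h; exists x.
Qed.

Lemma fc_convex X : fin_convex lt X ->
  (forall F, convex lt F -> (forall x, F x -> X x) -> finite_classes F) ->
  finite_classes X.
Proof.
move=> [I [r [rc rX]]] H; apply: (@fc_union I r) => [x /rX//|i].
by apply: H => // x rx; apply/rX; exists i.
Qed.

Lemma col_trans s x y z : col s x y -> col s y z -> col s x z.
Proof.
case: s => /=; [|exact: flt_trans|by move=> ? ?; apply: flt_trans; eassumption].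
by move=> [h1 h2] [h3 h4]; split=> /(flt_ntrans y) [].
Qed.

Lemma col_inj s t x y : col s x y -> col t x y -> s = t.
Proof.
have nn : flt x y -> flt y x -> False.
  by move=> h1 h2; exact: flt_irr (flt_trans h1 h2).
by case: s; case: t => //= h1 h2; exfalso; first
  [exact: (nn h1 h2)|exact: (nn h2 h1)|case: h1; auto|case: h2; auto].
Qed.

Lemma col_def s : def2 A (col s).
Proof. by case: s => /=; rewrite /def2; definability. Qed.

(** * Extension of a convex equivalence relation by a colour *)

Definition ext s x y := forall u v,
  hull x y u -> hull x y v -> far u v -> col s u v.

(** Frees [ext] from the particular hull, so that transitivity becomes the gluing of two sets with a
    common point. *)
Lemma extP s x y : ext s x y <-> exists Q : set M,
  [/\ convex lt Q, forall u v, Q u -> E u v -> Q v, Q x, Q y &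
      forall u v, Q u -> Q v -> far u v -> col s u v].
Proof.
split=> [H|[Q [Qc QE Qx Qy H]] u v xu xv].
  exists (hull x y); split=> //; first exact: hull_convex.
  - by move=> u v; exact: hull_ce.
  - exact: hull_l.
  - exact: hull_r.
by apply: H => //; apply: hull_sub (Qc) QE Qx Qy _.
Qed.

Lemma ext_ce s x y : E x y -> ext s x y.
Proof.
move=> xy u v [h1 h2] [h3 h4] uv; exfalso.
case: (far_total x u) => xu.
- by apply: h2; split=> //; apply: far_ce_l xu; exact: ce_sym.
- by apply: h4; split; apply: far_ce_l uv; rewrite //; apply: ce_trans xu; apply: ce_sym.
- by apply: h1; split=> //; apply: far_ce_r xy.
Qed.

Lemma ext_equiv s : convex_equiv lt (ext s).
Proof.
have sym x y : ext s x y -> ext s y x.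
  by move=> H u v /hullC hu /hullC hv; apply: H.
split; first split.
- by move=> x; apply: ext_ce; exact: ce_refl.
- exact: sym.
- move=> x y z /extP [Q [Qc QE Qx Qy HQ]] /extP [Q' [Qc' QE' Qy' Qz' HQ']].
  (* If [y] lies strictly between the classes of [u] and [v], the colours compose through [y];
     otherwise both points are in one of the two sets. *)
  have key (P P' : set M) u v : convex lt P -> convex lt P' ->
      (forall u v, P u -> E u v -> P v) -> (forall u v, P' u -> E u v -> P' v) ->
      P y -> P' y ->
      (forall u v, P u -> P v -> far u v -> col s u v) ->
      (forall u v, P' u -> P' v -> far u v -> col s u v) ->
      P u -> P' v -> far u v -> col s u v.
    move=> Pc Pc' PE PE' Py Py' HP HP' Pu Pv uv.
    case: (far_total u y) => uy.
    - case: (far_total y v) => yv.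
      + by apply: (@col_trans _ _ y); [apply: HP|apply: HP'].
      + by apply: HP => //; apply: PE yv.
      + by apply: HP => //; apply: Pc Pu Py _ _; apply: far_lt.
    - by apply: HP' => //; apply: PE' Py' _; exact: ce_sym.
    - by apply: HP' => //; apply: Pc' Py' Pv _ _; apply: far_lt.
  apply/extP; exists (Q `|` Q'); split.
  - exact: (convexU lt_lin Qc Qc' Qy Qy').
  - by move=> u v [/QE h /h|/QE' h /h]; [left|right].
  - by left.
  - by right.
  - move=> u v [Qu|Qu] [Qv|Qv] uv; [exact: HQ|exact: (key Q Q')|exact: (key Q' Q)|exact: HQ'].
- move=> a x y z /extP [Q [Qc QE Qa Qx HQ]] /extP [Q' [Qc' QE' Qa' Qz' HQ']] xy yz.
  (* On whichever side of [a] the point [y] falls, one of the two sets covers it. *)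
  have [ay|ya] := le_or_lt lt_lin a y.
    have Qy' : Q' y.
      by case: ay => [ay|<-//]; exact: Qc' Qa' Qz' ay yz.
    by apply/extP; exists Q'.
  by apply/extP; exists Q; split=> //; exact: Qc Qx Qa xy ya.
Qed.

(** * Terminal points and colours to the left *)

Hypothesis E_def : def2 A E.

Lemma far_def : def2 A far.
Proof. by rewrite /def2 /far; definability. Qed.
Hint Resolve far_def col_def : definability.

Lemma ext_def s : def2 A (ext s).
Proof. by rewrite /def2 /ext /hull; definability. Qed.
Hint Resolve ext_def : definability.

(** The bound is by classes: [~ far z c] says that [z] lies in the class of [c] or above it. *)
Definition initial_col s c x :=
  far c x /\ forall z, ~ far z c -> far z x -> col s z x.

Definition terminal x := forall s y, ext s x y -> E x y.

Lemma initial_col_def s : def2 A (initial_col s).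
Proof. by rewrite /def2 /initial_col; definability. Qed.
Hint Resolve initial_col_def : definability.

Lemma terminal_def : def1 A terminal.
Proof. by rewrite /def1 /terminal; definability. Qed.

Lemma initial_col_mono s c c' x :
  ~ far c' c -> far c' x -> initial_col s c x -> initial_col s c' x.
Proof.
move=> nc c'x [cx h]; split=> // z zc' zx; apply: h => //.
exact: nfar_trans zc' nc.
Qed.

(** [F] need not be saturated for [E]; inner points are those whose whole class is certain to lie in
    [F] once [F] is convex. *)
Definition inner (F : set M) x := exists a b, [/\ F a, F b, far a x & far x b].

Lemma inner_sub F x : convex lt F -> inner F x -> F x.
Proof. by move=> Fc [a [b [Fa Fb [ax _] [xb _]]]]; apply: Fc ax xb. Qed.

Lemma inner_conv F a b x : inner F a -> inner F b -> ~ far x a -> ~ far b x -> inner F x.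
Proof.
move=> [p [_ [Fp _ pa _]]] [_ [q [_ Fq _ bq]]] xa bx; exists p, q; split=> //.
  exact: far_nfar xa.
exact: nfar_far bq.
Qed.

Section InitialColour.
Variables (s : comparison) (F : set M).
Hypothesis F_conv : convex lt F.
Hypothesis F_init : forall x, F x -> exists c, initial_col s c x.
Hypothesis F_term : forall x, F x -> terminal x.

(** An initial colour persists when its starting point moves up. If no class lay strictly between
    [c] and [x], all pairs across these two classes would have colour [s], and [ext s] would join
    them, against terminality. *)
Lemma inner_dense c x : inner F c -> inner F x -> far c x ->
  exists u, [/\ far c u, far u x & initial_col s u x].
Proof.
move=> Fc Fx cx; have [c1 c1x] := F_init (inner_sub F_conv Fx).
have [cc1|ncc1] := pselect (far c c1); first by exists c1; split=> //; case: c1x.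
have cxW : initial_col s c x := initial_col_mono ncc1 cx c1x.
apply: contrapT => nobetween.
have {}nobetween w : far c w -> ~ far w x.
  move=> cw wx; apply: nobetween; exists w; split=> //.
  by apply: initial_col_mono cxW => //; exact: far_asym.
have : ext s c x.
  move=> u v /(hull_far _ cx) [uc xu] /(hull_far _ cx) [vc xv] uv.
  have ux : far u x by case: (far_ntrans x uv).
  have cv : far c v by case: (far_ntrans c uv).
  have vx : ~ far v x := nobetween _ cv.
  have Exv : E x v by apply/ceP.
  have [c2 c2v] : exists c, initial_col s c v.
    by apply/F_init/(inner_sub F_conv)/(inner_conv Fx Fx).
  case: (c2v) => c2v1; apply=> //.
  move=> uc2; have [|cc2] := far_ntrans c uc2 => //.
  by apply: (nobetween _ cc2); apply: far_ce_r c2v1 _; exact: ce_sym.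
case: (ext_equiv s) => -[_ sym _] _ /sym /(F_term (inner_sub F_conv Fx)).
by move=> /ceP [].
Qed.

(** The new alternation is at the top: [x] has initial colour [s] from [u], and if all of [[x4, x)]
    had it as well, [ext s] would join [x3] and [x2]. *)
Lemma inner_alt n c x : inner F c -> inner F x -> far c x ->
  exists u, [/\ far c u, far u x & alt lt (initial_col s u) n x].
Proof.
have btw a b w : inner F a -> inner F b -> far a w -> far w b -> inner F w.
  by move=> Fa Fb aw wb; apply: inner_conv Fa Fb _ _; exact: far_asym.
elim: n c x => [|n IH] c x Fc Fx cx.
  by have [u [? ? _]] := inner_dense Fc Fx cx; exists u.
have [u1 [cu1 u1x u1W]] := inner_dense Fc Fx cx.
have Fu1 := btw _ _ _ Fc Fx cu1 u1x.
(* With [u1 < x4 < x3 < x2 < x] in distinct classes, the hull of [x3] and [x2], which contains their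
   full classes, stays strictly between [x4] and [x]. *)
have [x2 [ux2 x2x _]] := inner_dense Fu1 Fx u1x.
have Fx2 := btw _ _ _ Fu1 Fx ux2 x2x.
have [x3 [ux3 x32 _]] := inner_dense Fu1 Fx2 ux2.
have Fx3 := btw _ _ _ Fu1 Fx2 ux3 x32.
have [x4 [ux4 x43 _]] := inner_dense Fu1 Fx3 ux3.
have Fx4 := btw _ _ _ Fu1 Fx3 ux4 x43.
have [u [u1u ux altu]] := IH _ _ Fu1 Fx4 ux4.
have x4x : far x4 x by apply: far_trans x43 (far_trans x32 x2x).
exists u; split; [exact: far_trans cu1 u1u|exact: far_trans ux x4x|].
have uW : initial_col s u x.
  by apply: initial_col_mono u1W; [exact: far_asym|exact: far_trans ux x4x].
have [[y [x4y yx nW]]|h] := pselect (exists y, [/\ le lt x4 y, lt y x & ~ initial_col s u y]).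
  exists x, y; split=> //; first exact: le_refl.
  exact: alt_le altu.
exfalso; have : ext s x3 x2.
  move=> v w /(hull_far _ x32) [vx3 x2v] /(hull_far _ x32) [wx3 x2w] vw.
  have uv : far u v by apply: far_trans ux _; apply: far_nfar x43 vx3.
  have [uw] : initial_col s u w.
    apply: contrapT => nW; apply: h; exists w; split=> //.
      by left; apply: far_lt; apply: far_nfar x43 wx3.
    by apply: far_lt; apply: nfar_far x2w x2x.
  by apply=> //; exact: far_asym.
by move/(F_term (inner_sub F_conv Fx3)) => /ceP [].
Qed.

Lemma inner_single x y : inner F x -> inner F y -> E x y.
Proof.
have [N HN] := M_alt (initial_col_def s).
have nf a b : inner F a -> inner F b -> ~ far a b.
  by move=> Fa Fb /(inner_alt N Fa Fb) [u [_ _ /HN]].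
by move=> Fx Fy; apply/ceP; split; apply: nf.
Qed.

End InitialColour.

(** Only a lowest and a highest class are lost in passing to the inner points. *)
Lemma fc_inner F : finite_classes (inner F) -> finite_classes F.
Proof.
move=> fF; apply: (@fc_union2 (fun x => F x /\ forall a, F a -> ~ far a x)
  (fun x => inner F x \/ (F x /\ forall a, F a -> ~ far x a))).
- move=> x Fx; have [[a [Fa ax]]|h] := pselect (exists a, F a /\ far a x).
    right; have [[b [Fb bx]]|h] := pselect (exists b, F b /\ far x b).
      by left; exists a, b.
    by right; split=> // b Fb xb; apply: h; exists b.
  by left; split=> // b Fb xb; apply: h; exists b.
- by apply: fc_single => x y [Fx hx] [Fy hy]; apply/ceP; split; [apply: hy|apply: hx].
- apply: (@fc_union2 (inner F) (fun x => F x /\ forall a, F a -> ~ far x a)) => //.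
  by apply: fc_single => x y [Fx hx] [Fy hy]; apply/ceP; split; [apply: hx|apply: hy].
Qed.

Lemma fin_convex1 X : def1 A X -> fin_convex lt X.
Proof.
move=> HX; have [u] := carrier_inhabited M.
by apply: (M_wom (W := fun _ => X) _ u); rewrite /def2; definability.
Qed.

Lemma fc_initial_col s :
  finite_classes (fun x => terminal x /\ exists c, initial_col s c x).
Proof.
apply: fc_convex => [|F Fc FH].
  have := terminal_def => td.
  by apply: fin_convex1; rewrite /def1; definability.
apply: fc_inner; apply: fc_single => x y.
by apply: (@inner_single s) => // z /FH [].
Qed.

(** * Jumps over the preceding class, and finiteness of terminal points *)

Definition adj a b := far a b /\ forall w, far a w -> ~ far w b.

Lemma adj_def : def2 A adj.
Proof. by rewrite /def2 /adj; definability. Qed.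
Hint Resolve adj_def : definability.

Lemma adj_unique a a' z z' : adj a z -> adj a' z' -> E z z' -> E a a'.
Proof.
move=> [az h] [az' h'] zz'; apply/ceP; split=> aa'.
  by apply: (h _ aa'); apply: far_ce_r az' _; exact: ce_sym.
by apply: (h' _ aa'); apply: far_ce_r az _.
Qed.

(** A definable lower bound for the rank of the class of [b] among the classes met by [F]. *)
Fixpoint depth (F : set M) n b :=
  if n is n'.+1 then F b /\ exists a, far a b /\ depth F n' a else F b.

Lemma depth_in F n b : depth F n b -> F b.
Proof. by case: n => //= n []. Qed.

(** Points of the same exact depth are equivalent, so bounded depth means finitely many classes. *)
Lemma fc_depth F n : (forall b, ~ depth F n b) -> finite_classes F.
Proof.
move=> h; suff H m : finite_classes (fun x => F x /\ ~ depth F m x).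
  by apply: fc_sub (H n) => x Fx.
elim: m => [|m IH].
  by apply: (@fc_sub _ (fun=> False)) => [x [] //|]; apply: fc_single.
apply: (@fc_union2 (fun x => F x /\ ~ depth F m x)
  (fun x => depth F m x /\ ~ depth F m.+1 x)) => //.
  by move=> x [Fx dx]; have [d|d] := pselect (depth F m x); [right|left].
apply: fc_single => x y [dx ndx] [dy ndy]; apply/ceP; split=> xy.
  by apply: ndy; split; [exact: depth_in dy|exists x].
by apply: ndx; split; [exact: depth_in dx|exists y].
Qed.

(** The class of [a] may stick out of [F]; depth at least two provides a point [a''] of [F] below
    [z'], which keeps [z'] in [F] by convexity. *)
Lemma depth_adj F m a z z' : convex lt F ->
  depth F m.+2 z -> adj a z -> E a z' -> depth F m.+1 z'.
Proof.
move=> Fc [Fz [a' [a'z [Fa' [a'' [aa' da'']]]]]] [az h] az'.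
have a''z' : far a'' z'.
  apply: far_ce_r az'; apply: far_nfar aa' _ => /h; exact.
split; last by exists a''.
apply: Fc (depth_in da'') Fz _ _; apply: far_lt => //.
by apply: far_ce_l az; exact: ce_sym.
Qed.

(** The obstruction to an initial colour at a point whose class has an immediate predecessor. *)
Definition jump (g : M -> M -> Prop) b := exists a, adj a b /\
  exists z z', [/\ E a z, E a z', g z b & ~ g z' b].

(** Both truth values of [g _ b] pass from a class of jump points to the preceding class, the true
    one by transitivity and the false one by negative transitivity. Hence [{x | g x b}] splits class
    after class below [b] and alternates once every two classes. *)
Lemma fc_jump g : def2 A g -> (forall x y z, g x y -> g y z -> g x z) ->
  (forall x y z, g x z -> g x y \/ g y z) -> finite_classes (jump g).
Proof.
move=> gd gt gn; apply: fc_convex => [|F Fc FJ].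
  apply: fin_convex1; rewrite /def1 /jump.
  apply: (@dfn_ext _ _ _ _ (fun v : 'I_1 -> M => exists a, adj a (v ord0) /\
    exists z z', E a z /\ E a z' /\ g z (v ord0) /\ ~ g z' (v ord0))).
    move=> v; split=> -[a [ab [z [z' H]]]]; exists a; split=> //; exists z, z'.
      by case: H => ? [? [? ?]].
    by case: H.
  by definability.
have [N HN] : exists N, forall u b, ~ alt lt (fun x => g x u) N b.
  by apply: (M_alt (W := fun u x => g x u)); rewrite /def2; definability.
(* Two predecessor steps for each of the [N] alternations, two to reach [w] and [w'], and one level
   in reserve for staying inside [F]. *)
apply: (@fc_depth _ N.*2.+3) => b db.
have claim n z z' : depth F n.*2.+1 z -> depth F n.*2.+1 z' -> E z z' ->
    g z b -> ~ g z' b -> forall w, E z w -> alt lt (fun x => g x b) n w.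
  elim: n z z' => // n IH z z'; rewrite doubleS => dz dz' zz' gz gz' w zw.
  have [a [az [z2 [_ [az2 _ gz2 _]]]]] := FJ _ (depth_in dz).
  have [a' [az' [_ [y2 [_ ay2 _ gy2]]]]] := FJ _ (depth_in dz').
  have dz2 := depth_adj Fc dz az az2.
  have dy2 := depth_adj Fc dz' az' ay2.
  have z2y2 : E z2 y2.
    apply: ce_trans (ce_trans _ (adj_unique az az' zz')) ay2.
    exact: ce_sym.
  (* The order of [z2] and [y2] within their class is unknown, so the point outside is taken one
     class further down. *)
  have [c [cz2 [z3 [_ [cz3 _ gz3 _]]]]] := FJ _ (depth_in dz2).
  have [c' [cy2 [_ [y3 [_ cy3 _ gy3]]]]] := FJ _ (depth_in dy2).
  have dz3 := depth_adj Fc dz2 cz2 cz3.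
  have dy3 := depth_adj Fc dy2 cy2 cy3.
  have z3y3 : E z3 y3.
    apply: ce_trans (ce_trans _ (adj_unique cz2 cy2 z2y2)) cy3.
    exact: ce_sym.
  have ng u v : ~ g u v -> ~ g v b -> ~ g u b by move=> h1 h2 /(gn _ v) [].
  have gz2b := gt _ _ _ gz2 gz.
  have gy3b := ng _ _ gy3 (ng _ _ gy2 gz').
  exists z2, y3; split=> //.
  - left; apply: far_lt; apply: far_ce_r zw; apply: far_ce_l (proj1 az).
    exact: ce_sym.
  - apply: far_lt; apply: far_ce_l (proj1 cz2).
    by apply: ce_sym; apply: ce_trans (adj_unique cz2 cy2 z2y2) cy3.
  - by apply: (IH z3 y3) => //; exact: gt gz3 gz2b.
have [a [ab [z [z' [az az' gz gz']]]]] := FJ _ (depth_in db).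
have dz := depth_adj Fc db ab az; have dz' := depth_adj Fc db ab az'.
have [a2 [az2 [w [_ [aw _ gw _]]]]] := FJ _ (depth_in dz).
have [a3 [az3 [_ [w' [_ aw' _ gw']]]]] := FJ _ (depth_in dz').
have dw := depth_adj Fc dz az2 aw; have dw' := depth_adj Fc dz' az3 aw'.
have zz' : E z z' by apply: ce_trans az'; exact: ce_sym.
apply: (HN b w); apply: (claim _ w w') => //; last exact: ce_refl.
- apply: ce_trans (ce_trans _ (adj_unique az2 az3 zz')) aw'.
  exact: ce_sym.
- exact: gt gw gz.
- by move=> /(gn _ z') [].
Qed.

(** By [germ] the colour of [(z, b)] is eventually constant as [z] rises towards the class of [b].
    Either this gives an initial colour, or the constancy starts in the class just below, on which
    the colours agree or vary. *)
Lemma initial_or_jump b : (exists a, far a b) ->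
  [\/ exists s c, initial_col s c b, jump flt b | jump (fun x y => flt y x) b].
Proof.
move=> ab.
have germ_col s : exists2 c, far c b & forall z, far z b -> le lt c z ->
    (col s z b <-> col s c b).
  apply: (germ lt_lin _ ab).
  apply: (M_wom (W := fun u x => col s x u)).
  have := col_def s => cd; by rewrite /def2; definability.
have [c1 c1b h1] := germ_col Lt; have [c2 c2b h2] := germ_col Gt.
have [c [cb c1c c2c]] : exists c, [/\ far c b, le lt c1 c & le lt c2 c].
  case: (le_or_lt lt_lin c1 c2) => h; [exists c2|exists c1]; split=> //.
  - exact: le_refl. - exact: le_refl. - by left.
(* [germ] speaks of points above [c], an initial colour of whole classes; starting from a class
   strictly between [c] and [b] removes the difference. *)
have [[s [w [cw wb hw]]]|noinit] := pselect (exists s w,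
    [/\ far c w, far w b & forall z, far z b -> le lt c z -> col s z b]).
  constructor 1; exists s, w; split=> // z zw zb; apply: hw => //.
  by left; apply: far_lt; apply: far_nfar cw zw.
have [s hs] : exists s, forall z, far z b -> le lt c z -> col s z b.
  have le1 z : le lt c z -> le lt c1 z by apply: le_trans.
  have le2 z : le lt c z -> le lt c2 z by apply: le_trans.
  have [l1|l1] := pselect (col Lt c1 b).
    by exists Lt => z zb /le1 cz; apply/h1.
  have [l2|l2] := pselect (col Gt c2 b).
    by exists Gt => z zb /le2 cz; apply/h2.
  by exists Eq => z zb cz; split=> [/(h1 z zb (le1 _ cz))|/(h2 z zb (le2 _ cz))].
have adjc : adj c b.
  by split=> // w cw wb; apply: noinit; exists s, w.
have init t : (forall z, E c z -> col t z b) -> exists s c, initial_col s c b.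
  move=> h; exists t, c; split=> // z zc zb; apply: h; apply/ceP; split=> // cz.
  by case: adjc => _ /(_ _ cz).
have [[z [cz zb]]|n1] := pselect (exists z, E c z /\ flt z b).
  have [[z' [cz' zb']]|n2] := pselect (exists z, E c z /\ ~ flt z b).
    by constructor 2; exists c; split=> //; exists z, z'.
  constructor 1; apply: (init Lt) => w cw; apply: contrapT => nw; apply: n2.
  by exists w.
have [[z [cz zb]]|n3] := pselect (exists z, E c z /\ flt b z).
  have [[z' [cz' zb']]|n2] := pselect (exists z, E c z /\ ~ flt b z).
    by constructor 3; exists c; split=> //; exists z, z'.
  constructor 1; apply: (init Gt) => w cw; apply: contrapT => nw; apply: n2.
  by exists w.
constructor 1; apply: (init Eq) => w cw; split=> h; [apply: n1|apply: n3]; by exists w.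
Qed.

(** A terminal point is in the lowest class, or has an initial colour, or is a jump for [flt] or its
    converse; each case covers finitely many classes. *)
Lemma fc_terminal : finite_classes terminal.
Proof.
apply: (@fc_union2 (fun x => ~ exists a, far a x)
  (fun x => terminal x /\ exists a, far a x)) => [x tx||].
- by have [h|h] := pselect (exists a, far a x); [right|left].
- by apply: fc_single => x y hx hy; apply/ceP; split=> h;
    [apply: hy; exists x|apply: hx; exists y].
apply: (@fc_union2 (fun x => exists s, terminal x /\ exists c, initial_col s c x)
  (fun x => jump flt x \/ jump (fun x y => flt y x) x)).
- move=> x [tx /initial_or_jump [[s h]|h|h]]; [left|right|right].
  + by exists s.
  + by left.
  + by right.
- pose I3 := [:: Lt; Eq; Gt].
  apply: (@fc_union 'I_3 (fun i x => terminal x /\ exists c, initial_col (nth Lt I3 i) c x)).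
    move=> x [[] h]; [exists (inord 1)|exists ord0|exists (inord 2)];
      by rewrite ?inordK.
  by move=> i; exact: fc_initial_col.
- apply: (@fc_union2 (jump flt) (jump (fun x y => flt y x))) => //.
  + by apply: fc_jump.
  + apply: fc_jump => //.
    * by rewrite /def2; definability.
    * by move=> x y z h1 h2; apply: flt_trans h2 h1.
    * by move=> x y z /(flt_ntrans y) []; [right|left].
Qed.

End Far.
End ConvexEquivalence.

(** * Equivalence relations with finitely many classes *)

Section FiniteIndex.
Context (L : language) (M : structure L) (A : set M) (lt : M -> M -> Prop).
Hypothesis lt_lin : strict_linear_order lt.
Hypothesis lt_def : def2 A lt.
Hypothesis M_wom : forall W, def2 A W -> forall u, fin_convex lt (W u).
Local Notation ltT := (lt_trans lt_lin).

Lemma eq_convex_equiv : convex_equiv lt (@eq M).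
Proof.
split=> [|a x y z <- <- xy yx]; first by split=> // x y z ->.
by case: (lt_asym lt_lin xy yx).
Qed.

(** A given representative may lie outside [X], where [E] need not imply [E'], so representatives
    are chosen afresh in [X]; [m0] serves for classes missing [X]. *)
Lemma fc_refine (E E' : M -> M -> Prop) X :
  Equivalence E -> (forall x y, X x -> X y -> E x y -> E' x y) ->
  finite_classes E X -> finite_classes E' X.
Proof.
move=> [_ Es Et] EE' [I [r Hr]]; have [m0] := carrier_inhabited M.
have /choice [q Hq] : forall i, exists y, forall x, X x -> E (r i) x -> X y /\ E y x.
  move=> i; have [[y [Xy ry]]|h] := pselect (exists y, X y /\ E (r i) y).
    by exists y => x Xx rx; split=> //; apply: Et rx; exact: Es.
  by exists m0 => x Xx rx; case: h; exists x.
exists I, q => x Xx; have [i ri] := Hr x Xx; have [Xq qx] := Hq i x Xx ri.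
by exists i; exact: EE'.
Qed.

Lemma fc_inter (E E' : M -> M -> Prop) X : Equivalence E -> Equivalence E' ->
  finite_classes E X -> finite_classes E' X ->
  finite_classes (fun x y => E x y /\ E' x y) X.
Proof.
move=> [_ Es Et] [_ Es' Et'] [I [r Hr]] [J [q Hq]].
have [m0] := carrier_inhabited M.
have /choice [p Hp] : forall ij : I * J, exists y, forall x,
    E (r ij.1) x -> E' (q ij.2) x -> E y x /\ E' y x.
  move=> [i j] /=.
  have [[y [ry qy]]|h] := pselect (exists y, E (r i) y /\ E' (q j) y).
    by exists y => x rx qx; split; [apply: Et rx; exact: Es|apply: Et' qx; exact: Es'].
  by exists m0 => x rx qx; case: h; exists x.
exists (I * J)%type, p => x Xx; have [i ri] := Hr x Xx; have [j qj] := Hq x Xx.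
by exists (i, j); exact: Hp.
Qed.

(** A class leaving [F] upwards contains every later point of [F], so only one does; likewise
    downwards. *)
Lemma fc_cut E F : convex_equiv lt E -> convex lt F ->
  finite_classes E (fun x => F x /\ exists y, E x y /\ ~ F y).
Proof.
move=> Ec Fc; have Er := ce_refl Ec; have Es := ce_sym Ec.
apply: (@fc_union2 _ _ _ (fun x => F x /\ exists y, [/\ E x y, ~ F y & lt x y])
  (fun x => F x /\ exists y, [/\ E x y, ~ F y & lt y x])).
- move=> x [Fx [y [xy Fy]]]; case: (lt_total lt_lin x y) => h.
  + by left; split=> //; exists y.
  + by case: Fy; rewrite -h.
  + by right; split=> //; exists y.
- have H x x' : F x -> F x' -> lt x x' -> (exists y, [/\ E x y, ~ F y & lt x y]) -> E x x'.
    move=> Fx Fx' xx' [y [Exy Fy xy]]; case: (lt_total lt_lin x' y) => h.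
    + exact: (ce_conv Ec) xx' h Exy.
    + by rewrite h.
    + by case: Fy; apply: Fc Fx Fx' xy h.
  apply: fc_single => x x' [Fx hx] [Fx' hx']; case: (lt_total lt_lin x x') => h.
  + exact: H.
  + by rewrite h.
  + by apply: Es; exact: H.
- have H x x' : F x -> F x' -> lt x' x -> (exists y, [/\ E x y, ~ F y & lt y x]) -> E x x'.
    move=> Fx Fx' xx' [y [Exy Fy xy]]; case: (lt_total lt_lin x' y) => h.
    + by case: Fy; apply: Fc Fx' Fx h xy.
    + by rewrite h.
    + have Eyx' : E y x' by apply: (ce_conv Ec) h xx' (Es _ _ Exy).
      exact: (ce_trans Ec) Exy Eyx'.
  apply: fc_single => x x' [Fx hx] [Fx' hx']; case: (lt_total lt_lin x x') => h.
  + by apply: Es; exact: H.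
  + by rewrite h.
  + exact: H.
Qed.

Definition finite_index E :=
  [/\ def2 A E, convex_equiv lt E & finite_classes E setT].

Lemma inter_convex_equiv E E' : convex_equiv lt E -> convex_equiv lt E' ->
  convex_equiv lt (fun x y => E x y /\ E' x y).
Proof.
move=> [[Er Es Et] Ec] [[Er' Es' Et'] Ec']; split.
  split=> [x|x y [xy xy']|x y z [xy xy'] [yz yz']]; split=> //; eauto.
move=> a x y z [ax ax'] [az az'] xy yz; split.
  exact: (Ec a x y z).
exact: (Ec' a x y z).
Qed.

Lemma finite_index_total : finite_index (fun _ _ => True).
Proof.
split; [|split=> //|exact: fc_single].
by rewrite /def2; apply: dfn_ext (dfn_imp (dfn_False A _) (dfn_False A _)).
Qed.

Lemma finite_index_inter E E' : finite_index E -> finite_index E' ->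
  finite_index (fun x y => E x y /\ E' x y).
Proof.
move=> [d [e c] f] [d' [e' c'] f']; split.
- by rewrite /def2; definability.
- exact: inter_convex_equiv.
- exact: fc_inter.
Qed.

(** The hull for equality is the closed interval between two points in either order, so the classes
    are the convex components of [X] and of its complement. *)
Definition same_component (X : set M) x y :=
  forall z, hull lt (@eq M) x y z -> (X z <-> X x).

Lemma same_component_convex_equiv X : convex_equiv lt (same_component X).
Proof.
have Ec := eq_convex_equiv.
have sub (Q : set M) x y z : convex lt Q -> Q x -> Q y -> hull lt eq x y z -> Q z.
  by move=> Qc; apply: (hull_sub lt_lin Ec Qc) => u v Qu <-.
split; first split.
- move=> x z zh; have Qc : convex lt (eq x).
    by move=> a b c <- <- xb bx; case: (lt_asym lt_lin xb bx).
  by rewrite (sub _ _ _ _ Qc erefl erefl zh).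
- move=> x y xy z yz; rewrite (xy z); last exact/hullC.
  by rewrite (xy y) //; exact: hull_r.
- move=> x y z xy yz w xz.
  have xyX : X y <-> X x by apply: xy; exact: hull_r.
  pose Q := hull lt eq x y `|` hull lt eq y z.
  have Qc : convex lt Q.
    apply: (@convexU _ _ _ lt_lin _ _ y) => //; try exact: hull_convex.
      exact: hull_r.
    exact: hull_l.
  have Qx : Q x by left; exact: hull_l.
  have Qz : Q z by right; exact: hull_r.
  have [h|h] := sub Q x z w Qc Qx Qz xz; first exact: xy.
  by rewrite -xyX; exact: yz.
- move=> a x y z ax az xy yz w ayw.
  have [ya|ay] := le_or_lt lt_lin y a.
    apply: ax; apply: sub ayw; [exact: hull_convex|exact: hull_l|].
    case: ya => [ya|->]; last exact: hull_l.
    by apply: (hull_convex lt_lin Ec (hull_r lt_lin _ _ _) (hull_l lt_lin _ _ _)) xy ya.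
  apply: az; apply: sub ayw; [exact: hull_convex|exact: hull_l|].
  by apply: (hull_convex lt_lin Ec (hull_l lt_lin _ _ _) (hull_r lt_lin _ _ _)) ay yz.
Qed.

Lemma same_component_def X : def1 A X -> def2 A (same_component X).
Proof.
by move=> Xd; rewrite /def2 /same_component /hull /far; definability.
Qed.

Lemma finite_index_same_component X : def1 A X -> finite_index (same_component X).
Proof.
move=> Xd; split.
- exact: same_component_def.
- exact: same_component_convex_equiv.
have sub (Q : set M) x y z : convex lt Q -> Q x -> Q y -> hull lt eq x y z -> Q z.
  by move=> Qc; apply: (hull_sub lt_lin eq_convex_equiv Qc) => u v Qu <-.
have nXd : def1 A (fun x => ~ X x) by rewrite /def1; definability.
apply: (@fc_union2 _ _ _ X (fun x => ~ X x)) => [x _||].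
- by have [h|h] := pselect (X x); [left|right].
- apply: fc_convex (fin_convex1 M_wom Xd) _ => F Fc FX.
  apply: fc_single => x y Fx Fy z /(sub _ _ _ _ Fc Fx Fy) /FX Xz.
  by split=> // _; exact: FX.
- apply: fc_convex (fin_convex1 M_wom nXd) _ => F Fc FX.
  apply: fc_single => x y Fx Fy z /(sub _ _ _ _ Fc Fx Fy) /FX Xz.
  by split=> // /(FX _ Fx).
Qed.

Lemma depth_def E n : def2 A E -> def1 A (depth lt E setT n).
Proof.
move=> Ed; have fd := far_def lt_def Ed.
elim: n => [|n IH] /=; rewrite /def1.
  by apply: dfn_ext (dfn_imp (dfn_False A _) (dfn_False A _)).
apply: (@dfn_ext _ _ _ _ (fun v : 'I_1 -> M =>
    exists a, far lt E a (v ord0) /\ depth lt E setT n a)).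
  by move=> v; split=> [|[]].
by definability.
Qed.

(** No point of the class is needed as a parameter: the class is singled out by the number of
    classes below it. *)
Lemma eclass_def E a : finite_index E -> def1 A (eclass E a).
Proof.
move=> [Ed Ec [J [r Hr]]].
pose S b := [pred i : J | `[< far lt E (r i) b >]].
have Sn n b : depth lt E setT n b -> n <= #|S b|.
  elim: n b => //= n IH b [_ [c [cb /IH]]] /leq_ltn_trans; apply.
  have [i ic] := Hr c I; apply/proper_card/properP; split.
    apply/fintype.subsetP => j /asboolP jc; apply/asboolP; exact: far_trans jc cb.
  exists i; apply/asboolP; first exact: (far_ce_l lt_lin Ec) ic cb.
  by case.
have [n da nda] : exists2 n, depth lt E setT n a & ~ depth lt E setT n.+1 a.
  apply: contrapT => h.
  have : depth lt E setT #|J|.+1 a.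
    elim: #|J|.+1 => // n IH; apply: contrapT => nd; apply: h; by exists n.
  by move=> /Sn; rewrite leqNgt ltnS max_card.
have dE m x y : depth lt E setT m x -> E x y -> depth lt E setT m y.
  case: m => //= m [_ [c [cx dc]]] xy; split=> //; exists c; split=> //.
  exact: (far_ce_r lt_lin Ec) cx xy.
have d0 := depth_def n Ed; have d1 := depth_def n.+1 Ed.
rewrite /def1; apply: (@dfn_ext _ _ _ _ (fun v : 'I_1 -> M =>
  depth lt E setT n (v ord0) /\ ~ depth lt E setT n.+1 (v ord0))).
  move=> v; rewrite /eclass; split=> [[d nd]|av /=]; last first.
    split; first exact: dE av.
    by move=> d; apply: nda; apply: (dE n.+1 _ _ d); exact: (ce_sym Ec).
  apply/(ceP lt_lin Ec); split=> h; first by apply: nd; split=> //; exists a.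
  by apply: nda; split=> //; exists (v ord0).
by apply: dfn_and; [|apply: dfn_not]; apply: (dfn1 _ _).
Qed.

Lemma finite_set_eclass (E : M -> M -> Prop) (X : set M) : Equivalence E -> finite_classes E X ->
  finite_set (eclass E @` X).
Proof.
move=> [_ Es Et] [I [r Hr]].
apply: (@sub_finite_set _ _ ((fun i => eclass E (r i)) @` setT)); last first.
  exact/finite_image/finite_finset.
move=> _ [x /Hr [i ri] <-]; exists i => //; apply/seteqP; split=> y; rewrite /eclass /=.
  by move=> ry; apply: Et ry; exact: Es.
exact: Et.
Qed.

Lemma eclass_eq (E : M -> M -> Prop) a b : Equivalence E -> E a b -> eclass E a = eclass E b.
Proof.
move=> [_ Es Et] ab; apply/seteqP; split=> y; rewrite /eclass /=.
  by move=> ay; apply: Et ay; exact: Es.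
exact: Et.
Qed.

Lemma finite_index_partition E : finite_index E ->
  finite_convex_partition A lt (eclass E @` setT).
Proof.
move=> Ei; case: (Ei) => [Ed Ec Ef]; case: (Ec) => Eq Ecv; split.
- exact: finite_set_eclass.
- split.
  + apply/seteqP; split=> // x _; exists (eclass E x); first by exists x.
    exact: (ce_refl Ec).
  + move=> _ _ [a _ <-] [b _ <-] [x [/= ax bx]].
    by rewrite (eclass_eq Eq ax) (eclass_eq Eq bx).
  + by move=> _ [a _ <-]; exists a; exact: (ce_refl Ec).
- move=> _ [a _ <-]; split; last exact: Ecv.
  by apply/def1E; exact: eclass_def.
Qed.

(* A relation chosen separately on each class of [E] is still definable, since
   the finitely many classes are. *)
Definition class_glue (E : M -> M -> Prop) (G : set M -> M -> M -> Prop) x y :=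
  E x y /\ G (eclass E x) x y.

Lemma class_glue_def E G : finite_index E -> (forall Q, def2 A (G Q)) -> def2 A (class_glue E G).
Proof.
move=> [Ed [Eq Ecv] [J [r Hr]]] Gd; rewrite /def2.
apply: (@dfn_ext _ _ _ _ (fun v : 'I_2 -> M => E (v ord0) (v (lift ord0 ord0)) /\
  forall i, eclass E (r i) (v ord0) -> G (eclass E (r i)) (v ord0) (v (lift ord0 ord0)))).
  move=> v; rewrite /class_glue; split=> -[vE h]; split=> //.
    by have [i ri] := Hr (v ord0) I; rewrite -(eclass_eq Eq ri); apply: h.
  by move=> i ri; rewrite (eclass_eq Eq ri).
have cd i := eclass_def (r i) (And3 Ed (conj Eq Ecv) (ex_intro _ J (ex_intro _ r Hr))).
by definability.
Qed.

Lemma class_glue_convex_equiv E G : convex_equiv lt E -> (forall Q, convex_equiv lt (G Q)) ->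
  convex_equiv lt (class_glue E G).
Proof.
move=> [Eq Ec] Gc; case: (Eq) => Er Es Et; rewrite /class_glue; split; first split.
- by move=> x; split=> //; exact: (ce_refl (Gc _)).
- move=> x y [xy Gxy]; split; first exact: Es.
  by rewrite -(eclass_eq Eq xy); exact: (ce_sym (Gc _)).
- move=> x y z [xy Gxy] [yz Gyz]; split; first exact: Et yz.
  by apply: (ce_trans (Gc _)) Gxy _; rewrite (eclass_eq Eq xy).
- move=> a x y z [ax Gax] [az Gaz] xy yz; split; first exact: (Ec a x y z).
  exact: (proj2 (Gc _) a x y z).
Qed.

Lemma finite_min Q a : finite_set Q -> Q a -> exists2 m, Q m & forall y, Q y -> le lt m y.
Proof.
move=> /finite_set_range [k [r Hr]].
pose S b := [pred i | `[< lt (r i) b >]].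
have [n] := ubnP #|S a|; elim: n a => // n IH a; rewrite ltnS => Sn Qa.
have [[y [Qy ya]]|h] := pselect (exists y, Q y /\ lt y a).
  apply: (IH y) (Qy); apply: leq_trans Sn; apply/proper_card/properP; split.
    by apply/fintype.subsetP => i /asboolP iy; apply/asboolP; exact: ltT iy ya.
  have [i ri] := Hr y Qy; exists i; apply/asboolP; rewrite ri //.
  exact: (lt_irr lt_lin).
exists a => // y Qy; apply/(le_not_lt lt_lin) => ya; apply: h; by exists y.
Qed.

End FiniteIndex.

(** * Towers of convex equivalence relations *)

Section Twist.
Context (L : language) (M : structure L) (A : set M) (lt : M -> M -> Prop).
Hypothesis lt_lin : strict_linear_order lt.
Hypothesis lt_def : def2 A lt.
Context (flt : M -> M -> Prop).
Hypothesis flt_def : def2 A flt.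
Hypothesis flt_irr : forall x, ~ flt x x.
Hypothesis flt_trans : forall x y z, flt x y -> flt y z -> flt x z.
Hypothesis flt_ntrans : forall x y z, flt x z -> flt x y \/ flt y z.
Hypothesis M_wom : forall W, def2 A W -> forall u, fin_convex lt (W u).
Hypothesis M_alt : forall W, def2 A W -> exists N, forall u b, ~ alt lt (W u) N b.

Local Notation eqM := (@eq M).
Local Notation ext := (ext lt flt).
Local Notation col := (col flt).
Local Notation eq_conv := (eq_convex_equiv lt_lin).

Fixpoint tower (sg : seq comparison) : M -> M -> Prop :=
  if sg is s :: tl then ext (tower tl) s else eqM.

Lemma tower_conv sg : convex_equiv lt (tower sg).
Proof. by elim: sg => [|s sg IH]; [exact: eq_conv|apply: ext_equiv]. Qed.

Lemma tower_def sg : def2 A (tower sg).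
Proof. by elim: sg => [|s sg IH]; [exact: def2_eq|apply: ext_def]. Qed.

Lemma tower_sub s sg x y : tower sg x y -> tower (s :: sg) x y.
Proof. exact: (ext_ce lt_lin flt (tower_conv sg)). Qed.

Lemma tower_col s sg x y :
  tower (s :: sg) x y -> far lt (tower sg) x y -> col s x y.
Proof. by apply; [exact: hull_l|exact: hull_r]. Qed.

(** Hereditary growth: below the class of [x] hangs a tree of classes in which every node, at each
    level of the word, has at least two children. *)
Fixpoint splits (sg : seq comparison) : set M :=
  if sg is s :: tl then
    fun x => (exists y, tower sg x y /\ ~ tower tl x y) /\
             forall y, tower sg x y -> splits tl y
  else setT.

Lemma splits_def sg : def1 A (splits sg).
Proof.
elim: sg => [|s sg IH]; rewrite /def1.
  by apply: dfn_ext (dfn_imp (dfn_False A _) (dfn_False A _)).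
have d := tower_def (s :: sg); have d' := tower_def sg.
by cbn [splits]; definability.
Qed.

Lemma splits_tail s sg x : splits (s :: sg) x -> splits sg x.
Proof. by move=> [_]; apply; exact: (ce_refl (tower_conv (s :: sg))). Qed.

Lemma splits_far s sg x : splits (s :: sg) x ->
  exists a b, [/\ tower (s :: sg) x a, tower (s :: sg) x b & far lt (tower sg) a b].
Proof.
move=> [[y [xy nxy]] _]; have xx := ce_refl (tower_conv (s :: sg)) x.
case: (far_total lt_lin (tower_conv sg) x y) => // h.
  by exists x, y.
by exists y, x.
Qed.

Local Arguments splits : simpl never.

(** A repeated colour adds nothing: pairs separated at the level [t] and pairs equivalent there
    would have the same colour. If [s] were [Eq], the whole class of [x] at the level [t] would be
    incomparable to [y], hence to itself, and [t] would be [Eq] too. *)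
Lemma splits_alternate s t sg x : splits [:: s, t & sg] x -> s <> t /\ s <> Eq.
Proof.
move=> h; have [[y [xy nxy]] _] := h.
have tw := tower_conv [:: s, t & sg]; have tw1 := tower_conv (t :: sg).
have tw0 := tower_conv sg.
have [a [b [xa xb ab]]] := splits_far (splits_tail h).
have nst : s <> t.
  move=> st; apply: nxy => u v hu hv uv.
  have up p q : far lt (tower sg) p q -> ~ tower (t :: sg) p q -> far lt (tower (t :: sg)) p q.
    by case=> pq _ npq; split.
  have hullS w : hull lt (tower sg) x y w -> hull lt (tower (t :: sg)) x y w.
    apply: (hull_sub lt_lin tw0).
    - exact: hull_convex.
    - by move=> p q hp pq; apply: (hull_ce lt_lin tw1) hp _; exact: tower_sub.
    - exact: hull_l.
    - exact: hull_r.
  have [tuv|ntuv] := pselect (tower (t :: sg) u v); first exact: tower_col tuv uv.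
  by rewrite -st; apply: xy; [exact: hullS|exact: hullS|exact: up].
split=> // sE; apply: nst; rewrite sE.
have Exy c : tower (t :: sg) x c -> col Eq c y.
  move=> xc; have [_ Es Et] := proj1 tw.
  have cy : tower [:: s, t & sg] c y.
    by apply: Et xy; apply: Es; exact: tower_sub.
  case: (far_total lt_lin tw1 c y) => h'.
  - by have := tower_col cy h'; rewrite sE.
  - by case: nxy; exact: (ce_trans tw1) xc h'.
  - by have [? ?] : col Eq y c by have := tower_col (Es _ _ cy) h'; rewrite sE.
have ab' : tower (t :: sg) a b by apply: (ce_trans tw1) xb; exact: (ce_sym tw1).
apply: (col_inj flt_irr flt_trans _ (tower_col ab' ab)).
apply: (col_trans flt_trans flt_ntrans (Exy _ xa)).
by have [? ?] := Exy _ xb.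
Qed.

(* Descending to the leftmost of two subclasses at each level yields a point
   whose colours to the right alternate with the levels. *)
Lemma splits_alt n sg x : n.*2 <= size sg -> (0 < n -> head Eq sg = Lt) ->
  splits sg x -> exists a b, [/\ tower sg x a, tower sg x b & alt lt (flt a) n b].
Proof.
elim: n sg x => [|n IH] sg x.
  by move=> _ _ _; exists x, x; split=> //; exact: (ce_refl (tower_conv sg)).
case: sg => [|s [|t sg]] //; rewrite doubleS !ltnS => sz /(_ isT) hd h.
have {}hd : s = Lt := hd; rewrite {s}hd in h *.
have [ts _] := splits_alternate h.
have tw := tower_conv [:: Lt, t & sg]; have tw1 := tower_conv (t :: sg).
have tw0 := tower_conv sg.
have [x1 [y1 [xx1 xy1 xy1f]]] := splits_far h.
have h1 : splits (t :: sg) x1 by case: h => _; apply.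
have [x2 [y2 [xx2 xy2 xy2f]]] := splits_far h1.
have h2 : splits sg x2 by case: h1 => _; apply.
(* Above the bottom letter there is no [Eq] and no repetition, so [Lt] is followed by [Gt] and then
   by [Lt] again. *)
have hd : 0 < n -> head Eq sg = Lt.
  case: n sz {IH} => // n; rewrite doubleS.
  case: sg h1 h2 {h tw tw1 tw0 xx1 xy1 xy1f xx2 xy2 xy2f} => [|u [|v sg]] //.
  move=> /splits_alternate [tu tE] /splits_alternate [_ uE] _ _ /=.
  by case: t u ts tu tE uE => [] [].
have [a [b [x2a x2b ab]]] := IH sg x2 sz hd h2.
have x1a : tower (t :: sg) x1 a by apply: (ce_trans tw1) xx2 _; exact: tower_sub.
have fay1 : far lt (tower (t :: sg)) a y1.
  by apply: (far_ce_l lt_lin tw1) xy1f; exact: (ce_sym tw1).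
have xa : tower [:: Lt, t & sg] x a by apply: (ce_trans tw) xx1 _; exact: tower_sub.
exists a, y1; split=> //.
(* [a] and [y1] are separated by [tower (t :: sg)] and get colour [Lt]; [a] and [y2] are separated
   only by [tower sg] and get colour [t], which is not [Lt]. *)
exists y1, y2; split.
- exact: le_refl.
- apply: far_lt; apply: (far_ce_l lt_lin tw1) xy1f; exact: (ce_sym tw1).
- apply: (@tower_col Lt (t :: sg) _ _ _ fay1); apply: (ce_trans tw) xy1; exact: (ce_sym tw).
- move=> ay2; apply: ts; apply: (@col_inj _ _ flt flt_irr flt_trans Lt t a y2 ay2).
  apply: (@tower_col t sg).
    by apply: (ce_trans tw1) xy2; exact: (ce_sym tw1).
  by apply: (far_ce_l lt_lin tw0) xy2f; exact: (ce_sym tw0).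
- apply: (alt_le lt_lin) ab; left; apply: far_lt.
  by apply: (far_ce_l lt_lin tw0) xy2f; exact: (ce_sym tw0).
Qed.

Lemma splits_bound : exists m, forall sg x, m <= size sg -> ~ splits sg x.
Proof.
(* With at least three letters the first two differ and neither is [Eq], so one of them is [Lt]; the
   word read from there still has at least [N.*2] letters. *)
have [N HN] := M_alt flt_def; exists N.*2.+3 => -[|s [|t [|u sg]]] x //.
rewrite /= !ltnS => sz h; have h' := splits_tail h.
have [st sE] := splits_alternate h; have [tu tE] := splits_alternate h'.
have fin sg' : N.*2 <= size sg' -> head Eq sg' = Lt -> ~ splits sg' x.
  by move=> sz' hd' /(splits_alt sz' (fun _ => hd')) [a [b [_ _ /HN]]].
case: s st sE h => // st _ h; first by apply: fin h => //=; rewrite ltnW // ltnW // ltnW.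
case: t tu tE st {h} h' => // _ _ _ h'; apply: fin h' => //=; by rewrite ltnW // ltnW.
Qed.

(** The word may vary with the point; only the finite-index relation is uniform. *)
Definition tame (X : set M) := exists2 E, finite_index A lt E &
  forall x, X x -> exists sg, forall y, E x y -> tower sg x y.

Lemma tame_union X Y Z : (forall x, Z x -> X x \/ Y x) -> tame X -> tame Y -> tame Z.
Proof.
move=> ZXY [E Ei hE] [E' Ei' hE']; exists (fun x y => E x y /\ E' x y).
  exact: finite_index_inter.
by move=> x /ZXY [/hE|/hE'] [sg h]; exists sg => y [? ?]; exact: h.
Qed.

Lemma tame_ex (X : comparison -> set M) :
  (forall s, tame (X s)) -> tame (fun x => exists s, X s x).
Proof.
move=> tX; apply: (@tame_union (X Lt) (fun x => X Eq x \/ X Gt x)) => //.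
  by move=> x [[] h]; [right; left|left|right; right].
exact: (@tame_union (X Eq) (X Gt)).
Qed.

(** The line is cut into the components of [X] and of its complement, and only the former are cut
    further by [tower sg]. *)
Lemma tame_fc X sg : def1 A X -> finite_classes (tower sg) X -> tame X.
Proof.
move=> Xd Xf; have Es := same_component_convex_equiv lt_lin X.
have tw := tower_conv sg; have td := tower_def sg.
have sd := same_component_def lt_def Xd.
have sX x y : same_component lt X x y -> (X y <-> X x) by apply; exact: hull_r.
exists (fun x y => same_component lt X x y /\ (X x -> tower sg x y)); last first.
  by move=> x Xx; exists sg => y []; auto.
split; first by rewrite /def2; definability.
- split; first split.
  + by move=> x; split=> [|_]; [exact: (ce_refl Es)|exact: (ce_refl tw)].
  + move=> x y [xy h]; split; first exact: (ce_sym Es).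
    by move=> /(sX _ _ xy) /h; exact: (ce_sym tw).
  + move=> x y z [xy h] [yz h']; split; first exact: (ce_trans Es xy yz).
    by move=> Xx; exact: (ce_trans tw (h Xx) (h' (proj2 (sX _ _ xy) Xx))).
  + move=> a x y z [ax h] [az h'] xy yz; split; first exact: (proj2 Es a x y z).
    by move=> Xa; exact: (proj2 tw a x y z (h Xa) (h' Xa) xy yz).
- have [_ _ sf] := finite_index_same_component lt_lin lt_def M_wom Xd.
  have sub Y : finite_classes (same_component lt X) Y by apply: fc_sub sf.
  apply: (@fc_union2 _ _ _ X (fun x => ~ X x)) => [x _||].
  + by have [h|h] := pselect (X x); [left|right].
  + apply: (fc_refine (E := fun x y => same_component lt X x y /\ tower sg x y)).
    * exact: (proj1 (inter_convex_equiv Es tw)).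
    * by move=> x y _ _ [].
    * by apply: fc_inter; [exact: (proj1 Es)|exact: (proj1 tw)|exact: sub|].
  + apply: (fc_refine (proj1 Es)) (sub _) => x y nx _ xy; by split.
Qed.

(** Induction on the room left below the bound on word length. A point of [splits sg] is terminal
    for [tower sg], or some colour [s] enlarges its class. The larger class then stays in
    [splits sg], which lengthens the word, or leaves it, which finitely many classes do. The empty
    word gives the whole line. *)
Lemma tame_splits sg : tame (splits sg).
Proof.
have [m Hm] := splits_bound.
have [k] := ubnP (m - size sg); elim: k sg => // k IH sg; rewrite ltnS => ksg.
have [msg|msg] := leqP m (size sg).
  by exists (fun _ _ => True); [exact: finite_index_total|move=> x /(Hm _ _ msg)].
have tw := tower_conv sg; have td := tower_def sg.
apply: (@tame_union (terminal lt flt (tower sg))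
  (fun x => exists s, (splits sg x /\ exists y, tower (s :: sg) x y /\ ~ splits sg y) \/
    splits (s :: sg) x)).
- move=> x sx; have [tx|ntx] := pselect (terminal lt flt (tower sg) x); first by left.
  right; apply: contrapT => h; apply: ntx => s y xy; apply: contrapT => nxy.
  apply: h; exists s.
  have [[z [xz nz]]|h] := pselect (exists z, tower (s :: sg) x z /\ ~ splits sg z).
    by left; split=> //; exists z.
  right; split; first by exists y.
  by move=> z xz; apply: contrapT => nz; apply: h; exists z.
- apply: (@tame_fc _ sg); first exact: terminal_def.
  exact: (fc_terminal lt_lin lt_def flt_def flt_trans flt_ntrans M_wom M_alt tw td).
- apply: tame_ex => s.
  apply: (@tame_union (fun x => splits sg x /\ exists y, tower (s :: sg) x y /\ ~ splits sg y)
    (splits (s :: sg))) => //; last first.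
    by apply: IH; apply: leq_trans ksg; rewrite /= ltn_sub2l.
  have sd := splits_def sg; have td' := tower_def (s :: sg).
  apply: (@tame_fc _ (s :: sg)); first by rewrite /def1; definability.
  have [J [r [rc rS]]] := fin_convex1 M_wom sd.
  apply: (@fc_union _ _ _ J (fun i x => r i x /\ exists y, tower (s :: sg) x y /\ ~ r i y)).
    move=> x [/rS [i ri] [y [xy ny]]]; exists i; split=> //; exists y; split=> // ry.
    by apply: ny; apply/rS; exists i.
  by move=> i; apply: (fc_cut lt_lin) => //; exact: tower_conv.
Qed.

(** * Iterated twists of the order *)

Definition twist (Fs : seq (M -> M -> Prop)) := foldl (@lt_twist M) lt Fs.

Definition mono (b : bool) x y := if b then ~ flt y x else ~ flt x y.

Definition def_chain (Fs : seq (M -> M -> Prop)) :=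
  (forall i, def2 A (nth eqM Fs i) /\ convex_equiv lt (nth eqM Fs i)) /\
  forall i j, i <= j < size Fs -> forall x y, nth eqM Fs i x y -> nth eqM Fs j x y.

Lemma twist_out Fs x y : (forall i, i < size Fs -> ~ nth eqM Fs i x y) ->
  (twist Fs x y <-> lt x y).
Proof.
rewrite /twist; elim/last_ind: Fs => //= Fs F IH; rewrite size_rcons => h.
rewrite foldl_rcons /lt_twist IH; last first.
  by move=> i iF; have := h i (ltnW iF); rewrite nth_rcons iF.
have := h (size Fs) (leqnn _); rewrite nth_rcons ltnn eqxx => nF.
by split=> [[[/nF]|[]]|] //; right.
Qed.

(** Both directions [b] are treated together. Pairs separated by [tower sg] keep their order under
    twists by relations inside it, so the sequence for the tail works unless [s] is the colour
    opposite to [b]. In that case the other direction is arranged first and then reversed by a last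
    twist by [tower (s :: sg)]. *)
Lemma twist_tower sg b : exists Fs, [/\ def_chain Fs,
  forall i, i < size Fs -> forall x y, nth eqM Fs i x y -> tower sg x y &
  forall x y, tower sg x y -> twist Fs x y -> mono b x y].
Proof.
elim: sg b => [|s sg IH] b.
  exists [::]; split=> //.
    split=> [i|i j]; last by rewrite ltn0 andbF.
    by rewrite nth_nil; split; [exact: def2_eq|exact: eq_conv].
  by move=> x _ <- /(lt_irr lt_lin).
have stepA c : s <> (if c then Gt else Lt) -> exists Fs, [/\ def_chain Fs,
    forall i, i < size Fs -> forall x y, nth eqM Fs i x y -> tower sg x y &
    forall x y, tower (s :: sg) x y -> twist Fs x y -> mono c x y].
  move=> sc; have [Fs [Fc Fsub Fm]] := IH c; exists Fs; split=> // x y xy tw.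
  have [xy'|nxy] := pselect (tower sg x y); first exact: Fm.
  have lxy : lt x y by apply/(@twist_out Fs) => // i iF /(Fsub i iF).
  have := tower_col xy (conj lxy nxy); rewrite /mono.
  case: c {Fm} sc; case: s {xy IH} => //= _.
  - by case.
  - by move=> h1 h2; exact: flt_irr (flt_trans h1 h2).
  - by case.
  - by move=> h1 h2; exact: flt_irr (flt_trans h1 h2).
have [sb|/contrapT sb] := pselect (s <> (if b then Gt else Lt)).
  have [Fs [Fc Fsub Fm]] := stepA b sb; exists Fs; split=> // i iF x y /(Fsub i iF).
  exact: tower_sub.
have [|Fs [[Fd Fi] Fsub Fm]] := stepA (~~ b); first by rewrite sb; case: b {sb}.
exists (rcons Fs (tower (s :: sg))).
have sub i : i < size Fs -> forall x y, nth eqM Fs i x y -> tower (s :: sg) x y.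
  by move=> iF x y /(Fsub i iF); exact: tower_sub.
split; first split.
- move=> i; rewrite nth_rcons; case: ltnP => // _; case: eqP => _.
    by split; [exact: tower_def|exact: tower_conv].
  by split; [exact: def2_eq|exact: eq_conv].
- move=> i j; rewrite size_rcons ltnS => /andP[ij jF] x y.
  rewrite !nth_rcons; move: jF; rewrite leq_eqVlt => /orP[/eqP jE|jF].
    move: ij; rewrite jE ltnn eqxx leq_eqVlt => /orP[/eqP->|iF].
      by rewrite ltnn eqxx.
    by rewrite iF; exact: sub.
  by rewrite (leq_ltn_trans ij jF) jF; apply: Fi; rewrite ij.
- move=> i; rewrite size_rcons ltnS nth_rcons leq_eqVlt => /orP[/eqP->|iF].
    by rewrite ltnn eqxx.
  by rewrite iF; exact: sub.
- move=> x y xy; rewrite /twist foldl_rcons => -[[_ yx]|[]] //.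
  have := Fm y x (ce_sym (tower_conv (s :: sg)) xy) yx.
  by rewrite /mono; case: b {sb Fm}.
Qed.

Lemma foldl_twist_agree I (s : seq I) (F G : I -> M -> M -> Prop) (C : set M) ltF ltG :
  (forall x y, C x -> C y -> (ltF x y <-> ltG x y)) ->
  (forall i x y, C x -> C y -> (F i x y <-> G i x y)) ->
  forall x y, C x -> C y -> (foldl (@lt_twist M) ltF [seq F i | i <- s] x y <->
    foldl (@lt_twist M) ltG [seq G i | i <- s] x y).
Proof.
elim: s ltF ltG => //= i s IH ltF ltG hlt hFG; apply: IH => // x y Cx Cy.
by rewrite /lt_twist hFG // !hlt.
Qed.

(** Equality in front leaves the order unchanged, so sequences chosen on different classes can be
    given a common length. *)
Lemma twist_pad k Fs : twist (nseq k eqM ++ Fs) = twist Fs.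
Proof.
rewrite /twist foldl_cat; congr foldl; elim: k => //= k.
suff -> : lt_twist lt eqM = lt by [].
apply/funext => x; apply/funext => y; apply/propext; rewrite /lt_twist.
split=> [[[->]|[]]|xy] //; right; split=> // e.
by move: xy; rewrite e; exact: (lt_irr lt_lin).
Qed.

Lemma def_chain_pad k Fs : def_chain Fs -> def_chain (nseq k eqM ++ Fs).
Proof.
move=> [Fd Fi]; split=> [i|i j].
  rewrite nth_cat size_nseq nth_nseq.
  by case: ifP => _; rewrite ?if_same //; split; [exact: def2_eq|exact: eq_conv].
rewrite size_cat size_nseq => /andP[ij jk] x y.
rewrite !nth_cat size_nseq !nth_nseq; case: (ltnP i k) => ik.
  move=> ->; case: ltnP => // _.
  exact: (ce_refl (proj2 (Fd _))).
rewrite ltnNge (leq_trans ik ij) /=; apply: Fi.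
by rewrite leq_sub2r //= ltn_subLR // (leq_trans ik ij).
Qed.

(** Each class of a finite-index [E0] lies in a tower class and has its own sequence of twists;
    these are padded to equal length and glued level by level. *)
Lemma increasing_after_twist : exists (P : set (set M)) (m : nat) (E : 'I_m -> M -> M -> Prop),
  [/\ finite_convex_partition A lt P,
      forall i, definable_rel1 A (E i) /\ convex_equiv lt (E i),
      increasing_chain E &
      forall C, P C -> forall x y, C x -> C y -> lt_twists lt E x y -> ~ flt y x].
Proof.
have [E0 Ei hE0] := tame_splits [::]; case: (Ei) => E0d E0c [J [r Hr]].
have E0e := proj1 E0c.
(* Choosing by the class as a set makes the choice constant on the class; other sets get the empty
   sequence. *)
have /choice [Fs HFs] : forall Q : set M, exists Fs, def_chain Fs /\
    forall a, Q = eclass E0 a -> forall x y, Q x -> Q y -> twist Fs x y -> ~ flt y x.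
  move=> Q; have [[a Qa]|h] := pselect (exists a, Q = eclass E0 a); last first.
    exists [::]; split=> [|a Qa]; last by case: h; exists a.
    split=> [i|i j]; last by rewrite ltn0 andbF.
    by rewrite nth_nil; split; [exact: def2_eq|exact: eq_conv].
  have [sg Hsg] := hE0 a I; have [Fs [Fc _ Fm]] := twist_tower sg true.
  exists Fs; split=> // b _ x y; rewrite Qa => /Hsg ax /Hsg ay.
  by apply: Fm; apply: (ce_trans (tower_conv sg)) ay; exact: (ce_sym (tower_conv sg)).
pose m := \max_(j : J) size (Fs (eclass E0 (r j))).
pose pad Q := nseq (m - size (Fs Q)) eqM ++ Fs Q.
have padc Q : def_chain (pad Q) by apply: def_chain_pad; case: (HFs Q).
have size_pad a : size (pad (eclass E0 a)) = m.
  have [j ja] := Hr a I; rewrite -(eclass_eq E0e ja) size_cat size_nseq subnK //.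
  exact: (@leq_bigmax _ (fun j => size (Fs (eclass E0 (r j))))).
pose E (i : 'I_m) := class_glue E0 (fun Q => nth eqM (pad Q) i).
exists (eclass E0 @` setT), m, E; split.
- exact: finite_index_partition.
- move=> i; split.
    apply/def2E; apply: (class_glue_def lt_lin lt_def) => // Q.
    by case: (padc Q) => /(_ (i : nat)) [].
  by apply: class_glue_convex_equiv => // Q; case: (padc Q) => /(_ (i : nat)) [].
- move=> i j ij x y [xy h]; split=> //.
  by case: (padc (eclass E0 x)) => _ /(_ i j) H; apply: H h; rewrite ij size_pad ltn_ord.
move=> _ [a _ <-] x y Cx Cy; rewrite /lt_twists codomE => tw.
apply: (proj2 (HFs (eclass E0 a)) a) => //.
rewrite -(twist_pad (m - size (Fs (eclass E0 a)))) -/(pad _).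
have -> : pad (eclass E0 a) = [seq nth eqM (pad (eclass E0 a)) i | i : 'I_m <- enum 'I_m].
  rewrite (map_comp (nth eqM (pad (eclass E0 a))) (@nat_of_ord m)) val_enum_ord.
  by rewrite -[in iota _ _](size_pad a) map_nth_iota0 ?take_size.
(* On one class of [E0] the glued relations coincide with the padded sequence of that class. *)
apply: (proj1 (@foldl_twist_agree _ (enum 'I_m) E _ (eclass E0 a) lt lt _ _ x y Cx Cy)) tw => //.
move=> i u v Cu Cv; rewrite /E /class_glue -(eclass_eq E0e Cu); split=> [[]|] // h; split=> //.
by case: E0e => _ Es Et; apply: Et Cv; exact: Es.
Qed.

(** Only one extension of equality is made. [E0] cuts the line so that each class is inside or
    outside each [Y s]; on a class with a nonterminal point, a colour enlarging all its points is
    chosen. *)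
Lemma monotone_on_classes : exists (P : set (set M)) (E : M -> M -> Prop),
  [/\ finite_convex_partition A lt P,
      definable_rel1 A E /\ convex_equiv lt E,
      finite_set [set c | exists2 a, c = eclass E a & finite_set c],
      forall x y, E x y <-> exists2 C, P C & [/\ C x, C y & E x y] &
      forall C, P C -> exists s, forall a x y, C a -> E a x -> E a y -> lt x y -> col s x y].
Proof.
pose Y s x := exists y, ext eqM s x y /\ x <> y.
have eqd : def2 A eqM := @def2_eq _ _ _.
have extd s : def2 A (ext eqM s) := ext_def lt_def flt_def eqd s.
have extc s : convex_equiv lt (ext eqM s) := ext_equiv lt_lin flt_trans flt_ntrans eq_conv s.
have Yd s : def1 A (Y s) by rewrite /def1 /Y; definability.
have Yi s := finite_index_same_component lt_lin lt_def M_wom (Yd s).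
pose E0 x y := same_component lt (Y Lt) x y /\ (same_component lt (Y Eq) x y /\
  same_component lt (Y Gt) x y).
have Ei : finite_index A lt E0 by do 2!apply: finite_index_inter => //.
case: (Ei) => E0d E0c [J [r Hr]]; have [E0r E0s E0t] := proj1 E0c.
have E0Y s x y : E0 x y -> Y s x -> Y s y.
  have sY t : same_component lt (Y t) x y -> Y t x -> Y t y.
    by move=> xy Yx; apply/(xy y) => //; exact: hull_r.
  by move=> [h1 [h2 h3]]; case: s; apply: sY.
have /choice [s Hs] : forall Q : set M, exists s, forall a, Q = eclass E0 a ->
    forall x, Q x -> ~ terminal lt flt eqM x -> forall y, Q y -> Y s y.
  move=> Q; have [[x [a [Qa Qx ntx]]]|h] := pselect (exists x a,
      [/\ Q = eclass E0 a, Q x & ~ terminal lt flt eqM x]); last first.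
    by exists Eq => a Qa x Qx ntx; case: h; exists x, a.
  have [t Yt] : exists t, Y t x.
    apply: contrapT => h; apply: ntx => t y xy; apply: contrapT => nxy.
    by apply: h; exists t, y.
  exists t => b Qb _ _ _ y Qy; apply: E0Y Yt; move: Qx Qy; rewrite Qb => bx by_.
  by apply: E0t by_; exact: E0s.
pose E := class_glue E0 (fun Q => ext eqM (s Q)).
have Ec : convex_equiv lt E by apply: class_glue_convex_equiv.
have Ed : def2 A E by apply: (class_glue_def lt_lin lt_def).
have [Er Es Et] := proj1 Ec.
exists (eclass E0 @` setT), E; split.
- exact: finite_index_partition.
- by split=> //; apply/def2E.
- suff : finite_classes E (fun a => finite_set (eclass E a)).
    move/(finite_set_eclass (proj1 Ec)); apply: sub_finite_set => c [a -> fa].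
    by exists a.
  (* [Z] consists of the least points of nontrivial classes. A finite class has its least point in
     [Z], or is a single point that is terminal or whose extension leaves its class of [E0]. *)
  pose Z m := (exists y, E m y /\ m <> y) /\ forall y, E m y -> le lt m y.
  apply: (@fc_union2 _ _ _ (terminal lt flt eqM) (fun a =>
    (exists m, Z m /\ E m a) \/
    exists j, eclass E0 (r j) a /\
      exists y, ext eqM (s (eclass E0 (r j))) a y /\ ~ eclass E0 (r j) y)).
  + move=> a fa; have [ta|nta] := pselect (terminal lt flt eqM a); first by left.
    right; have [[y [ay nay]]|single] := pselect (exists y, E a y /\ a <> y).
      left; have [m Em Hm] := finite_min lt_lin fa (Er a).
      exists m; split; last exact: Es.
      split; last by move=> z mz; apply: Hm; exact: Et mz.
      have [am|nam] := pselect (a = m); first by exists y; rewrite -am.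
      by exists a; split; [exact: Es|move=> h; apply: nam].
    right; have [j ja] := Hr a I; exists j; split=> //.
    have [y [ay nay]] := Hs _ (r j) erefl a ja nta a ja.
    exists y; split=> // jy; apply: single; exists y; split=> //; split.
      by apply: E0t jy; exact: E0s.
    by rewrite -(eclass_eq (proj1 E0c) ja).
  + apply: (fc_refine (proj1 eq_conv)) => [x y _ _ ->//|].
    exact: (fc_terminal lt_lin lt_def flt_def flt_trans flt_ntrans M_wom M_alt eq_conv eqd).
  + apply: (@fc_union2 _ _ _ (fun a => exists m, Z m /\ E m a) (fun a =>
      exists j, eclass E0 (r j) a /\
      exists y, ext eqM (s (eclass E0 (r j))) a y /\ ~ eclass E0 (r j) y)) => //.
    * have Zd : def1 A Z by rewrite /def1 /Z /le; definability.
      have [K [q Hq]] : finite_classes E Z.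
        apply: fc_convex (fin_convex1 M_wom Zd) _ => F Fc FZ.
        (* A point of the class of [x] strictly between [x] and [y] would be in [Z], hence least in
           its class; so a second point of that class lies at or beyond [y]. *)
        have H x y : F x -> F y -> lt x y -> E x y.
          move=> Fx Fy xy; have [[z [xz nxz]] mx] := FZ x Fx.
          have ltxz : lt x z by case: (mx z xz).
          case: (lt_total lt_lin y z) => yz.
          - exact: (ce_conv Ec) xy yz xz.
          - by rewrite yz.
          - have [_ mz] := FZ z (Fc _ _ _ Fx Fy ltxz yz).
            by have /(le_not_lt lt_lin) := mz x (Es _ _ xz).
        apply: fc_single => x y Fx Fy; case: (lt_total lt_lin x y) => h.
        - exact: H.
        - by rewrite h.
        - by apply: Es; exact: H.
      by exists K, q => a [m [/Hq [k qm] ma]]; exists k; exact: Et ma.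
    * apply: (@fc_union _ _ _ J (fun j a => eclass E0 (r j) a /\
        exists y, ext eqM (s (eclass E0 (r j))) a y /\ ~ eclass E0 (r j) y)) => // j.
      apply: (fc_refine (proj1 (extc (s (eclass E0 (r j)))))); last first.
        by apply: (fc_cut lt_lin) => //; exact: (proj2 E0c).
      move=> x y [jx _] [jy _] xy; split; first by apply: E0t jy; exact: E0s.
      by rewrite -(eclass_eq (proj1 E0c) jx).
- move=> x y; split=> [xy|[C _ []//]]; exists (eclass E0 x); first by exists x.
  by split=> //; [exact: E0r|case: xy].
- move=> _ [a _ <-]; exists (s (eclass E0 a)) => b x y ab bx by_ xy.
  have [E0xy] : E x y by apply: Et by_; exact: Es.
  have ax : eclass E0 a x by apply: E0t ab _; case: bx.
  rewrite -(eclass_eq (proj1 E0c) ax); apply; [exact: hull_l|exact: hull_r|].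
  by split=> // e; move: xy; rewrite e; exact: (lt_irr lt_lin).
Qed.

End Twist.

(** * Passage from the function [f] to a preorder on the line *)

Lemma def2_preimage L (M : structure L) (A : set M) n (f : M -> 'I_n -> M)
    (R : ('I_n -> M) -> ('I_n -> M) -> Prop) :
  definable_fun A f -> definable_rel A R -> def2 A (fun x y => R (f x) (f y)).
Proof.
move=> /definableE fd /definableE Rd.
have graph m (i : 'I_m) (r : 'I_n -> 'I_m) : dfn A (fun v => f (v i) = (fun j => v (r j))).
  apply: dfn_ext (dfn_subst (vcat (fun=> i) r) fd) => v /=; rewrite vcat_lshift.
  by have -> : (fun j => v (vcat (fun=> i) r (rshift 1 j))) = (fun j => v (r j))
    by apply: funext => j; rewrite vcat_rshift.
apply: (@dfn_ext _ _ _ _ (fun v : 'I_2 -> M => exists p q,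
  f (v ord0) = p /\ f (v (lift ord0 ord0)) = q /\ R p q)).
  by move=> v; split=> [[p [q [<- [<-]]]]|h] //; exists (f (v ord0)), (f (v (lift ord0 ord0))).
do 2!apply: dfn_exs; apply: dfn_and; first exact: graph.
apply: dfn_and; first exact: (graph _ _ (@lshift n _)).
apply: dfn_ext (dfn_subst (vcat (fun j => rshift n (lshift 2 j)) (@lshift n _)) Rd) => v /=.
suff [-> ->] : (fun j => v (vcat (fun j => rshift n (lshift 2 j)) (@lshift n (n + 2)) (lshift n j)))
    = (fun j => v (rshift n (lshift 2 j))) /\
  (fun j => v (vcat (fun j => rshift n (lshift 2 j)) (@lshift n (n + 2)) (rshift n j)))
    = (fun j => v (lshift (n + 2) j)) by [].
by split; apply: funext => j; rewrite ?vcat_lshift ?vcat_rshift.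
Qed.

Theorem theorem3
  (L : language) (K : Type) (M : structure L) (hM : monster K M)
  (lt : formula L 2)
  (hlt : strict_linear_order (lt_of M lt))
  (hwom : weakly_ominimal_theory (Th M) lt)
  (A : set M) (hA : small K A)
  (n : nat) (D : set ('I_n -> M)) (ltD : ('I_n -> M) -> ('I_n -> M) -> Prop)
  (hD : definable A D) (hltD : definable_rel A ltD)
  (hDlin : strict_linear_order_on D ltD)
  (f : M -> ('I_n -> M)) (hfD : forall x, D (f x)) (hf : definable_fun A f) :
  (exists (P : set (set M)) (m : nat) (E : 'I_m -> M -> M -> Prop),
    [/\ finite_convex_partition A (lt_of M lt) P,
        forall i, definable_rel1 A (E i) /\ convex_equiv (lt_of M lt) (E i),
        increasing_chain E &
        forall C, P C ->
          increasing_on C (lt_twists (lt_of M lt) E) ltD f]) /\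
  (exists (P : set (set M)) (E : M -> M -> Prop),
    [/\ finite_convex_partition A (lt_of M lt) P,
        definable_rel1 A E /\ convex_equiv (lt_of M lt) E,
        finite_set [set c | exists2 a, c = eclass E a & finite_set c],
        forall x y, E x y <-> exists2 C, P C & [/\ C x, C y & E x y] &
        forall C, P C ->
          [\/ forall a, C a -> constant_on (eclass E a) f,
              forall a, C a ->
                strictly_increasing_on (eclass E a) (lt_of M lt) ltD f |
              forall a, C a ->
                strictly_decreasing_on (eclass E a) (lt_of M lt) ltD f]]).
Proof.
case: hM => _ hsat _; case: (hDlin) => ltD_D [ltD_irr ltD_trans] ltD_total.
(* Weak o-minimality is used in [M] itself, a model of its own theory. *)
have wom1 X : def1 setT X -> fin_convex (lt_of M lt) X.
  move=> /def1E /(hwom M (fun _ => id)) [F [/finite_set_range [k [r Hr]] Fc ->]].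
  exists 'I_k, (fun i x => F (r i) /\ r i x); split=> [i x y z [Fi rx] [_ rz] xy yz|x].
    by split=> //; exact: (Fc _ Fi x y z).
  split=> [[C FC Cx]|[i [Fr rx]]]; last by exists (r i).
  by have [i ri] := Hr C FC; exists i; rewrite ri.
have wom W : def2 A W -> forall u, fin_convex (lt_of M lt) (W u).
  by move=> Wd u; exact: (wom1 _ (def1_param u Wd)).
have ltd : def2 A (lt_of M lt) := def2_lt_of A lt.
have bnd W (Wd : def2 A W) := alt_bound hlt ltd hsat hA wom1 Wd.
have fltd := def2_preimage hf hltD.
have flt_irr x : ~ ltD (f x) (f x) := ltD_irr (f x).
have flt_trans x y z : ltD (f x) (f y) -> ltD (f y) (f z) -> ltD (f x) (f z).
  exact: ltD_trans.
have flt_total x y : [\/ ltD (f x) (f y), f x = f y | ltD (f y) (f x)].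
  exact: ltD_total.
have flt_ntrans x y z : ltD (f x) (f z) -> ltD (f x) (f y) \/ ltD (f y) (f z).
  move=> xz; case: (flt_total x y) => h; [by left|by right; rewrite -h|right].
  exact: ltD_trans h xz.
split.
  have [P [m [E [PP Ed Ei h]]]] :=
    increasing_after_twist hlt ltd fltd flt_irr flt_trans flt_ntrans wom bnd.
  exists P, m, E; split=> // C PC x y Cx Cy xy; have := h C PC x y Cx Cy xy.
  by case: (flt_total x y); [right|left|].
have [P [E [PP [Ed Ec] Ef EP h]]] :=
  monotone_on_classes hlt ltd fltd flt_trans flt_ntrans wom bnd.
(* The colours [Eq], [Lt], [Gt] become the three alternatives; under [Eq] the values are
   incomparable, hence equal by linearity of [ltD]. *)
exists P, E; split=> // C /h [[] hs]; [constructor 1|constructor 2|constructor 3].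
- move=> a Ca x y ax ay; case: (lt_total hlt x y) => xy; last first.
  + have [n1 n2] := hs a y x Ca ay ax xy.
    by case: (flt_total x y).
  + by rewrite xy.
  + have [n1 n2] := hs a x y Ca ax ay xy.
    by case: (flt_total x y).
- by move=> a Ca x y; exact: hs.
- by move=> a Ca x y; exact: hs.
Qed.
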